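(* Let $A=KQ/I$ be a gentle algebra. Let $M\in\mathrm{mod}(A,\mathbf d)$ with $\mathbf d=(d_1,\dots,d_n)$, and let $r=r_M:Q_1\to\mathbb N$, $a\mapsto\mathrm{rank}(M_a)$, be the rank function of $M$. The following are equivalent: (i) $M$ is singular; (ii) there exist $a,b\in Q_1$ with $s(a)=t(b)$ and $ab\in I$ such that the following hold: (1) $r(a)<d_{t(a)}$, $r(b)<d_{s(b)}$ and $r(a)+r(b)<d_{s(a)}$; (2) if $a'\in Q_1$ with $s(a')=t(a)$ and $a'a\in I$, then $r(a')+r(a)<d_{t(a)}$; (3) if $b'\in Q_1$ with $t(b')=s(b)$ and $bb'\in I$, then $r(b)+r(b')<d_{s(b)}$.
   Context: $K$ is an algebraically closed field; $\mathbb N$ includes $0$. A quiver $Q=(Q_0,Q_1,s,t)$ has finite sets $Q_0=\{1,\dots,n\}$ of vertices and $Q_1$ of arrows and maps $s,t:Q_1\to Q_0$ (starting and terminal vertex). A path of length $m$ is $a_1\cdots a_m$ with $s(a_i)=t(a_{i+1})$ (so $ab$ means first $b$, then $a$). A basic algebra is $A=KQ/I$ with $I$ admissible ($\mathfrak m^k\subseteq I\subseteq\mathfrak m^2$ for some $k\ge 2$, where $\mathfrak m\subset KQ$ is the ideal generated by the arrows). Finite-dimensional left $A$-modules are identified with representations $M=(M_i,M_a)_{i\in Q_0,a\in Q_1}$ of $Q$ annihilated by $I$. A basic algebra $A=KQ/I$ is gentle if: (i) for each $i\in Q_0$, $|\{a\in Q_1: s(a)=i\}|\le 2$ and $|\{a\in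 Q_1: t(a)=i\}|\le 2$; (ii) $I$ is generated by a set $\rho$ of paths of length $2$; (iii) if $a,b,c\in Q_1$ with $a\ne b$ and $t(a)=t(b)=s(c)$, then exactly one of $ca$, $cb$ is in $I$; (iv) if $a,b,c\in Q_1$ with $a\ne b$ and $s(a)=s(b)=t(c)$, then exactly one of $ac$, $bc$ is in $I$. For $\mathbf d\in\mathbb N^n$, $\mathrm{mod}(A,\mathbf d)$ is the affine scheme of representations of $A$ with dimension vector $\mathbf d$, i.e. the closed subscheme of $\prod_{a\in Q_1}\mathrm{Hom}_K(K^{d_{s(a)}},K^{d_{t(a)}})$ cut out by the entries of the matrix equations given by the relations in $I$; $\mathrm{Irr}(A,\mathbf d)$ is its set of irreducible components. A module $M\in\mathrm{mod}(A,\mathbf d)$ is smooth if $\dim T_M=\max\{\dim Z: Z\in\mathrm{Irr}(A,\mathbf d),\ M\in Z\}$, where $T_M$ is the tangent space at $M$ of the (possibly non-reduced) scheme $\mathrm{mod}(A,\mathbf d)$; otherwise $M$ is singular. *)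

(* Defs.v *)
From HB Require Import structures.
From mathcomp Require Import all_boot all_order all_algebra.
From mathcomp Require Import freeg mpoly.

Set Implicit Arguments.
Unset Strict Implicit.
Unset Printing Implicit Defensive.

Import GRing.Theory.
Local Open Scope ring_scope.

Section Ideals.
Variable R : pzRingType.
Implicit Types (I J S : R -> Prop).

Definition is_ideal I : Prop :=
  [/\ I 0, forall x y, I x -> I y -> I (x + y)
    & forall a x b, I x -> I (a * x * b)].

Definition ideal_gen S : R -> Prop :=
  fun x => forall I, is_ideal I -> (forall y, S y -> I y) -> I x.

Definition ideal_mul I J : R -> Prop :=
  ideal_gen (fun x => exists y z, [/\ I y, J z & x = y * z]).

Fixpoint ideal_exp I (k : nat) : R -> Prop :=
  if k is k'.+1 then ideal_mul I (ideal_exp I k') else fun=> True.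

End Ideals.

Record quiver := Quiver {
  nvert : nat;
  arrow : finType;
  src : arrow -> 'I_nvert;
  tgt : arrow -> 'I_nvert }.

Notation vertex Q := ('I_(nvert Q)).

(* A path is stored as (i, [:: a_1; ...; a_m]), where i is its starting     *)
(* vertex and src a_k = tgt a_(k.+1): the arrow a_m comes first and         *)
(* a_1 comes last. The trivial path at i is (i, [::]).                      *)
Section Paths.
Variable Q : quiver.

Definition walk_tgt (i : vertex Q) (s : seq (arrow Q)) : vertex Q :=
  if s is a :: _ then tgt a else i.

Fixpoint is_walk (i : vertex Q) (s : seq (arrow Q)) : bool :=
  if s is a :: s' then (src a == walk_tgt i s') && is_walk i s' else true.

Record qpath := QPath {
  qpath_val : vertex Q * seq (arrow Q);
  _ : is_walk qpath_val.1 qpath_val.2 }.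

HB.instance Definition _ := [isSub for qpath_val].
HB.instance Definition _ := [Choice of qpath by <:].

Definition psrc (p : qpath) : vertex Q := (qpath_val p).1.
Definition parrows (p : qpath) : seq (arrow Q) := (qpath_val p).2.
Definition ptgt (p : qpath) : vertex Q := walk_tgt (psrc p) (parrows p).
Definition plength (p : qpath) : nat := size (parrows p).

Definition trivial_path (i : vertex Q) : qpath := @QPath (i, [::]) isT.

Fact arrow_path_subproof (a : arrow Q) : is_walk (src a) [:: a].
Proof. by rewrite /= eqxx. Qed.

Definition arrow_path (a : arrow Q) : qpath :=
  @QPath (src a, [:: a]) (arrow_path_subproof a).

Lemma walk_tgt_cat (i j : vertex Q) s1 s2 :
  walk_tgt j s2 = i -> walk_tgt j (s1 ++ s2) = walk_tgt i s1.
Proof. by case: s1. Qed.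

Lemma is_walk_cat (i j : vertex Q) s1 s2 :
  walk_tgt j s2 = i -> is_walk j (s1 ++ s2) = is_walk i s1 && is_walk j s2.
Proof.
by move=> e; elim: s1 => //= a s1 ->; rewrite (walk_tgt_cat _ e) andbA.
Qed.

Fact pcat_subproof (p q : qpath) :
  psrc p = ptgt q -> is_walk (psrc q) (parrows p ++ parrows q).
Proof.
move=> e; rewrite (is_walk_cat _ (esym e)).
by case: p q {e} => p hp [q hq] /=; apply/andP.
Qed.

Definition pcat (p q : qpath) (e : psrc p = ptgt q) : qpath :=
  @QPath (psrc q, parrows p ++ parrows q) (pcat_subproof e).

End Paths.

Section PathAlgebra.
Variables (K : fieldType) (Q : quiver).

Definition path_algebra : Type := {freeg (qpath Q) / K}.
HB.instance Definition _ := GRing.Lmodule.copy path_algebra {freeg (qpath Q) / K}.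

Definition of_path (p : qpath Q) : path_algebra := << p >>.

Definition of_arrow (a : arrow Q) : path_algebra := of_path (arrow_path a).

Definition pathM (p q : qpath Q) : path_algebra :=
  if psrc p =P ptgt q is ReflectT e then of_path (pcat e) else 0.

Definition pa_one : path_algebra := \sum_(i < nvert Q) of_path (trivial_path i).

Definition pa_mul (x y : path_algebra) : path_algebra :=
  fglift (fun p => fglift (pathM p) y) x.

Lemma of_pathZ k p : k *: of_path p = << k *g p >> :> path_algebra.
Proof. by apply/eqP/freeg_eqP => q; rewrite coeffZ !coeffU mul1r. Qed.

Lemma pa_ind (P : path_algebra -> Prop) :
  P 0 -> (forall k p x, P x -> P (k *: of_path p + x)) -> forall x, P x.
Proof.
move=> P0 PS; elim/freeg_ind_dom0 => // k p x _ _ Px.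
by have := PS k p x Px; rewrite of_pathZ.
Qed.

Section Lift.
Variables (V : lmodType K) (f : qpath Q -> V).

Lemma fglift0 : fglift f (0 : path_algebra) = 0.
Proof. by have := lift_is_additive f 0 0; rewrite !subrr. Qed.

Lemma fgliftD (x y : path_algebra) :
  fglift f (x + y) = fglift f x + fglift f y.
Proof.
have N z : fglift f (- z) = - fglift f z.
  by rewrite -sub0r lift_is_additive fglift0 sub0r.
by rewrite -{1}[y]opprK lift_is_additive N opprK.
Qed.

Lemma fgliftU p : fglift f (of_path p) = f p.
Proof. by rewrite liftU scale1r. Qed.

Lemma fgliftZ k (x : path_algebra) : fglift f (k *: x) = k *: fglift f x.
Proof.
elim/pa_ind: x => [|c p x IH]; first by rewrite !(scaler0, fglift0).
by rewrite scalerDr !fgliftD IH scalerA !of_pathZ !liftU scalerDr scalerA.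
Qed.

End Lift.

Lemma pa_mulDl : left_distributive pa_mul +%R.
Proof. by move=> x y z; rewrite /pa_mul fgliftD. Qed.

Lemma pa_mulDr : right_distributive pa_mul +%R.
Proof.
move=> x y z; elim/pa_ind: x => [|k p x IH]; first by rewrite /pa_mul !fglift0 addr0.
by rewrite !(pa_mulDl (_ *: _)) IH /pa_mul !fgliftZ !fgliftU fgliftD scalerDr addrACA.
Qed.

Lemma pa_mul0x x : pa_mul 0 x = 0. Proof. exact: fglift0. Qed.
Lemma pa_mulx0 x : pa_mul x 0 = 0.
Proof. by apply: (@addrI _ (pa_mul x 0)); rewrite -pa_mulDr !addr0. Qed.

Lemma pa_mulZl k x y : pa_mul (k *: x) y = k *: pa_mul x y.
Proof. exact: fgliftZ. Qed.

Lemma pa_mulZr k x y : pa_mul x (k *: y) = k *: pa_mul x y.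
Proof.
elim/pa_ind: x => [|c p x IH]; first by rewrite !pa_mul0x scaler0.
rewrite !(pa_mulDl (_ *: _)) IH !pa_mulZl scalerDr; congr (_ + _).
by rewrite /pa_mul !fgliftU fgliftZ !scalerA mulrC.
Qed.

Lemma pa_mulUU p q : pa_mul (of_path p) (of_path q) = pathM p q.
Proof. by rewrite /pa_mul !fgliftU. Qed.

Lemma ptgt_pcat (p q : qpath Q) (e : psrc p = ptgt q) : ptgt (pcat e) = ptgt p.
Proof. exact: walk_tgt_cat (esym e). Qed.

Lemma pathMA p q r :
  pa_mul (of_path p) (pathM q r) = pa_mul (pathM p q) (of_path r).
Proof.
rewrite /pathM; case: eqP => [e1|n1]; case: eqP => [e2|n2];
  rewrite ?pa_mulx0 ?pa_mul0x // !pa_mulUU /pathM.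
- case: eqP => [e3|]; last by rewrite ptgt_pcat.
  case: eqP => [e4|//]; congr of_path.
  by apply: val_inj; rewrite /= /parrows /= catA.
- by case: eqP => // e3; case: n2; rewrite e3 ptgt_pcat.
- by case: eqP => // e3; case: n1; rewrite -e3.
Qed.

Lemma pa_mulA : associative pa_mul.
Proof.
move=> x y z; elim/pa_ind: x => [|k p x IHx]; first by rewrite !pa_mul0x.
rewrite !(pa_mulDl, pa_mulZl) IHx; congr (_ *: _ + _) => {k x IHx}.
elim/pa_ind: y => [|k q y IHy]; first by rewrite !(pa_mulx0, pa_mul0x).
rewrite !(pa_mulDl, pa_mulDr, pa_mulZl, pa_mulZr) IHy.
congr (_ *: _ + _) => {k y IHy}.
elim/pa_ind: z => [|k r z IHz]; first by rewrite !pa_mulx0.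
by rewrite !(pa_mulDr, pa_mulZr) IHz !pa_mulUU pathMA.
Qed.

Lemma pathM_trivl i p :
  pathM (trivial_path i) p = if i == ptgt p then of_path p else 0.
Proof.
rewrite /pathM; case: eqP => [e|//].
by congr of_path; apply: val_inj; rewrite /= /parrows /psrc; case: (qpath_val p).
Qed.

Lemma pathM_trivr i p :
  pathM p (trivial_path i) = if i == psrc p then of_path p else 0.
Proof.
rewrite /pathM; case: eqP => [e|n]; last by case: (i =P psrc p) n => // ->.
have e' : psrc p = i := e; rewrite ifT; last by rewrite e'.
congr of_path; apply: val_inj; rewrite /= /parrows /= cats0 -e'.
by rewrite /psrc; case: p {e e'} => -[].
Qed.

Lemma pa_mul1x : left_id pa_one pa_mul.
Proof.
move=> x; elim/pa_ind: x => [|k p x IH]; first by rewrite pa_mulx0.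
rewrite pa_mulDr IH pa_mulZr; congr (_ *: _ + _).
have -> : pa_mul pa_one (of_path p)
        = \sum_(i < nvert Q) pa_mul (of_path (trivial_path i)) (of_path p).
  by apply: (big_morph (pa_mul^~ _)) => [y z|]; rewrite ?pa_mulDl ?pa_mul0x.
rewrite (bigD1 (ptgt p)) //= big1 ?addr0 => [|i /negPf ni];
  by rewrite pa_mulUU pathM_trivl ?eqxx ?ni.
Qed.

Lemma pa_mulx1 : right_id pa_one pa_mul.
Proof.
move=> x; elim/pa_ind: x => [|k p x IH]; first by rewrite pa_mul0x.
rewrite pa_mulDl IH pa_mulZl; congr (_ *: _ + _).
have -> : pa_mul (of_path p) pa_one
        = \sum_(i < nvert Q) pa_mul (of_path p) (of_path (trivial_path i)).
  by apply: (big_morph (pa_mul _)) => [y z|]; rewrite ?pa_mulDr ?pa_mulx0.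
rewrite (bigD1 (psrc p)) //= big1 ?addr0 => [|i /negPf ni];
  by rewrite pa_mulUU pathM_trivr ?eqxx ?ni.
Qed.

HB.instance Definition _ := GRing.Zmodule_isPzRing.Build path_algebra
  pa_mulA pa_mul1x pa_mulx1 pa_mulDl pa_mulDr.

End PathAlgebra.

Section Gentle.
Variables (K : fieldType) (Q : quiver).
Implicit Types (I : path_algebra K Q -> Prop).

Definition arrow_ideal : path_algebra K Q -> Prop :=
  ideal_gen (fun x => exists a, x = of_arrow K a).

Definition admissible I : Prop :=
  [/\ is_ideal I,
      exists2 k, (2 <= k)%N & forall x, ideal_exp arrow_ideal k x -> I x
    & forall x, I x -> ideal_exp arrow_ideal 2 x].

Definition gen_by_paths2 I : Prop :=
  exists rho : qpath Q -> Prop,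
    (forall p, rho p -> plength p = 2) /\
    (forall x, I x <-> ideal_gen (fun y => exists2 p, rho p & y = of_path K p) x).

(* The product b a is the path "first a, then b" when tgt a = src b.       *)
Definition in_rel I (b a : arrow Q) : Prop := I (of_arrow K b * of_arrow K a).

Definition exactly_one (A B : Prop) : Prop := (A /\ ~ B) \/ (~ A /\ B).

Record gentle I : Prop := Gentle {
  gentle_admissible : admissible I;
  gentle_src : forall i : vertex Q, (#|[set a | src a == i]| <= 2)%N;
  gentle_tgt : forall i : vertex Q, (#|[set a | tgt a == i]| <= 2)%N;
  gentle_gen : gen_by_paths2 I;
  gentle_post : forall a b c : arrow Q,
    a != b -> tgt a = tgt b -> tgt b = src c ->
    exactly_one (in_rel I c a) (in_rel I c b);
  gentle_pre : forall a b c : arrow Q,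
    a != b -> src a = src b -> src b = tgt c ->
    exactly_one (in_rel I a c) (in_rel I b c) }.

End Gentle.

Section AffineGeometry.
Variables (K : fieldType) (N : nat).
Implicit Types (J : {mpoly K[N]} -> Prop) (X Z : 'rV[K]_N -> Prop).

Definition zero_locus J : 'rV[K]_N -> Prop :=
  fun x => forall f, J f -> f.@[x 0] = 0.

(* Unlike zero_locus, this depends on J itself and not only on its radical: *)
(* it is the Zariski tangent space of the scheme, which may be non-reduced.  *)
Definition tangent_space J (x : 'rV[K]_N) : 'rV[K]_N -> Prop :=
  fun v => forall f, J f -> \sum_(k < N) f^`M(k).@[x 0] * v 0 k = 0.

Definition tangent_dim J (x : 'rV[K]_N) (D : nat) : Prop :=
  exists2 T : {vspace 'rV[K]_N},
    forall v, v \in T <-> tangent_space J x v & \dim T = D.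

Definition subset X Z : Prop := forall x, X x -> Z x.

Definition zclosed Z : Prop := exists J, forall x, Z x <-> zero_locus J x.

Definition zirreducible Z : Prop :=
  (exists x, Z x) /\
  forall Z1 Z2, zclosed Z1 -> zclosed Z2 ->
    (forall x, Z x -> Z1 x \/ Z2 x) -> subset Z Z1 \/ subset Z Z2.

Definition irr_closed Z : Prop := zclosed Z /\ zirreducible Z.

Definition irr_component X Z : Prop :=
  [/\ irr_closed Z, subset Z X
    & forall Z', irr_closed Z' -> subset Z' X -> subset Z Z' -> subset Z' Z].

Definition irr_chain Z (m : nat) : Prop :=
  exists F : nat -> 'rV[K]_N -> Prop,
    (forall i, (i <= m)%N -> irr_closed (F i) /\ subset (F i) Z) /\
    (forall i, (i < m)%N -> subset (F i) (F i.+1) /\ ~ subset (F i.+1) (F i)).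

Definition krull_dim Z (D : nat) : Prop :=
  irr_chain Z D /\ forall m, irr_chain Z m -> (m <= D)%N.

Definition local_dim J (x : 'rV[K]_N) (D : nat) : Prop :=
  (exists Z, [/\ irr_component (zero_locus J) Z, Z x & krull_dim Z D]) /\
  (forall Z D', irr_component (zero_locus J) Z -> Z x -> krull_dim Z D' ->
     (D' <= D)%N).

Definition smooth_at J (x : 'rV[K]_N) : Prop :=
  exists2 D, tangent_dim J x D & local_dim J x D.

End AffineGeometry.

Definition rep (R : Type) (Q : quiver) (d : vertex Q -> nat) : Type :=
  forall a : arrow Q, 'M[R]_(d (tgt a), d (src a)).

Section Evaluation.
Variables (K : fieldType) (Q : quiver) (d : vertex Q -> nat).
Variables (R : comNzRingType) (c : K -> R) (M : rep R d).

(* conform_mx only transports along equalities of vertices here: on a walk *)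
(* a :: s, walk_tgt i s = src a.                                           *)
Fixpoint walk_mx (i : vertex Q) (s : seq (arrow Q)) : 'M[R]_(d (walk_tgt i s), d i) :=
  match s return 'M[R]_(d (walk_tgt i s), d i) with
  | [::] => 1%:M
  | a :: s' => M a *m conform_mx 0 (walk_mx i s')
  end.

Definition path_mx (p : qpath Q) : 'M[R]_(d (ptgt p), d (psrc p)) :=
  walk_mx (psrc p) (parrows p).

(* The block in Hom(R^(d i), R^(d j)) of the action of x on the sum of the R^(d i); *)
(* scalars of K are mapped to R by c.                                        *)
Definition pa_mx (x : path_algebra K Q) (i j : vertex Q) : 'M[R]_(d j, d i) :=
  \sum_(p <- dom x | (psrc p == i) && (ptgt p == j))
    c (coeff p x) *: conform_mx 0 (path_mx p).

End Evaluation.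

Section ModuleScheme.
Variables (K : fieldType) (Q : quiver).
Variables (I : path_algebra K Q -> Prop) (d : vertex Q -> nat).

Definition coord : finType :=
  {a : arrow Q & ('I_(d (tgt a)) * 'I_(d (src a)))%type}.

Definition ncoord : nat := #|{: coord}|.

Definition generic_rep : rep {mpoly K[ncoord]} d :=
  fun a => \matrix_(i, j) 'X_(enum_rank (Tagged _ (i, j) : coord)).

Definition rep_point (M : rep K d) : 'rV[K]_ncoord :=
  \row_k (let u : coord := enum_val k in M (tag u) (tagged u).1 (tagged u).2).

(* The ideal of mod(A, d) in affine space: it is generated by the entries of *)
(* the relations evaluated at matrices of indeterminates.                    *)
Definition mod_ideal : {mpoly K[ncoord]} -> Prop :=
  ideal_gen (fun f => exists x i j k l,
    I x /\ f = pa_mx (@mpolyC ncoord K) generic_rep x i j k l).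

Definition mod_scheme_pt (M : rep K d) : Prop :=
  zero_locus mod_ideal (rep_point M).

Definition annihilated (M : rep K d) : Prop :=
  forall x, I x -> forall i j, pa_mx id M x i j = 0.

Definition smooth_module (M : rep K d) : Prop :=
  smooth_at mod_ideal (rep_point M).

Definition singular_module (M : rep K d) : Prop := ~ smooth_module M.

Lemma conform_map_mx (R S : nzRingType) (f : {rmorphism R -> S}) m n m' n'
    (B : 'M[R]_(m, n)) (A : 'M[R]_(m', n')) :
  map_mx f (conform_mx B A) = conform_mx (map_mx f B) (map_mx f A).
Proof.
case: (eqVneq m' m) => [e1|ne]; last by rewrite !nonconform_mx // ne.
case: (eqVneq n' n) => [e2|ne]; last by rewrite !nonconform_mx // ne orbT.
by subst m n; rewrite !conform_mx_id.
Qed.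

Lemma rep_pointE (M : rep K d) (a : arrow Q) i j :
  rep_point M 0 (enum_rank (Tagged _ (i, j) : coord)) = M a i j.
Proof. by rewrite mxE enum_rankK. Qed.

Lemma meval_generic (M : rep K d) a :
  map_mx (meval (rep_point M 0)) (generic_rep a) = M a.
Proof. by apply/matrixP=> i j; rewrite !mxE mevalXU rep_pointE. Qed.

Lemma meval_walk_mx (M : rep K d) i s :
  map_mx (meval (rep_point M 0)) (walk_mx generic_rep i s) = walk_mx M i s.
Proof.
elim: s => [|a s IH] /=; first by rewrite map_mx1.
by rewrite map_mxM meval_generic conform_map_mx map_mx0 IH.
Qed.

Lemma meval_pa_mx (M : rep K d) x i j :
  map_mx (meval (rep_point M 0)) (pa_mx (@mpolyC ncoord K) generic_rep x i j)
  = pa_mx id M x i j.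
Proof.
rewrite /pa_mx raddf_sum /=; apply: eq_bigr => p _.
rewrite map_mxZ /= mevalC conform_map_mx map_mx0; congr (_ *: conform_mx _ _).
exact: meval_walk_mx.
Qed.

Lemma mod_scheme_ptP (M : rep K d) : mod_scheme_pt M <-> annihilated M.
Proof.
split=> [hM x Ix i j|hM f].
  apply/matrixP=> k l; rewrite -meval_pa_mx [LHS]mxE [RHS]mxE.
  by apply: hM => J _; apply; exists x, i, j, k, l.
move=> hf; apply: (hf (fun g => g.@[rep_point M 0] = 0)) => {f hf} [|f].
  split=> [|g h eg eh|g h k eh]; first exact: meval0.
    by rewrite mevalD eg eh addr0.
  by rewrite !mevalM eh mulr0 mul0r.
move=> [x [i [j [k [l [Ix ->]]]]]].
by have := hM x Ix i j; rewrite -meval_pa_mx => /matrixP/(_ k l); rewrite !mxE.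
Qed.

End ModuleScheme.

(* Main.v *)
Require Import Defs.
From HB Require Import structures.
From mathcomp Require Import all_boot all_order all_algebra.
From mathcomp Require Import freeg mpoly zify.
From Stdlib Require Import Classical.
Set Implicit Arguments.
Unset Strict Implicit.
Unset Printing Implicit Defensive.

(** Why the criterion holds. By gentleness an arrow [a] is the left factor of at
    most one relation [a b = 0] and the right factor of at most one relation
    [c a = 0]. The relations therefore string the arrows into linear or cyclic
    threads, and the module scheme is a product of schemes of complexes. Put
    [h_s(a) = d(s(a)) - r(a) - r(b)] and [h_t(a) = d(t(a)) - r(a) - r(c)], with
    the missing rank read as 0 when there is no such [b] or [c]: these are the
    dimensions of the homology of the complex [M] at both ends of [a]. For a
    relation [a b = 0] the numbers [h_t(b)] and [h_s(a)] agree, and conditions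
    (1)-(3) say that [h_s(b)], [h_s(a)] and [h_t(a)] are all positive.

    Up to base change at the ends of the arrows, a complex is determined by its
    ranks ([normal_form]): every matrix becomes a truncated identity. In this
    form the tangent equations [N_a M_b + M_a N_b = 0] involve at most two
    entries each, and the free entries can be listed ([tangent_lift_onto],
    [tangent_dimE]). The stratum with rank function [r'] is covered by open
    subsets, each contained in the image of a polynomial map to its closure
    ([param], [param_surj]) from an affine space of dimension the sum over [a] of
    [r'(a) (d(s(a)) + d(t(a)) - r'(a))] minus the sum of [r'(a) r'(b)] over the
    relations. If [M] lies in the closure of that stratum and
    [delta = r' - r_M], then [tangent_count_excess] gives

      dim T_M = dim(stratum r') + sum_a (h_t(a) - delta(a)) (h_s(a) - delta(a))
                + sum_(a b = 0) delta(a) delta(b)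

    with nonnegative summands. If some relation satisfies (1)-(3) they cannot all
    vanish, so every component through [M] has dimension smaller than [dim T_M].
    Otherwise [delta = min(h_s, h_t)] is admissible and makes all of them vanish
    ([fill_ranks_spec]), which gives a component through [M] of dimension
    [dim T_M].

    Dimensions are lengths of chains of irreducible closed sets, so two facts of
    dimension theory are needed. A chain of length [m] in [Z] yields, for every
    [s], [s^m] polynomials of degree [O(s)] that are linearly independent on [Z]
    ([chain_indep]); if a dense part of [Z] is parametrized by [D] variables,
    there are only [O(s^D)] of them, hence [m <= D] ([chain_length_le]).
    Conversely, a chain of affine subspaces of the parameter space gives a chain
    of closures of images, strictly increasing as soon as the parameters can be
    read off one after the other from the image ([image_chain]). *)

Import GRing.Theory.
Local Open Scope ring_scope.

(** * Polynomial functions *)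

Section PolyFun.
Variables (K : fieldType) (n : nat).
Implicit Types h k : 'rV[K]_n -> K.

Definition polyf h := exists f : {mpoly K[n]}, forall v, h v = f.@[v 0].

Lemma polyf_ext h k : h =1 k -> polyf h -> polyf k.
Proof. by move=> e [f hf]; exists f => v; rewrite -e. Qed.

Lemma polyf_const c : polyf (fun=> c).
Proof. by exists c%:MP => v; rewrite mevalC. Qed.

Lemma polyf_coord i : polyf (fun v => v 0 i).
Proof. by exists 'X_i => v; rewrite mevalXU. Qed.

Lemma polyf_add h k : polyf h -> polyf k -> polyf (fun v => h v + k v).
Proof. by move=> [f hf] [g hg]; exists (f + g) => v; rewrite mevalD hf hg. Qed.

Lemma polyf_mul h k : polyf h -> polyf k -> polyf (fun v => h v * k v).
Proof. by move=> [f hf] [g hg]; exists (f * g) => v; rewrite mevalM hf hg. Qed.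

Lemma polyf_opp h : polyf h -> polyf (fun v => - h v).
Proof. by move=> [f hf]; exists (- f) => v; rewrite mevalN hf. Qed.

Lemma polyf_sum (T : Type) (s : seq T) (P : pred T) (h : T -> 'rV[K]_n -> K) :
  (forall i, polyf (h i)) -> polyf (fun v => \sum_(i <- s | P i) h i v).
Proof.
move=> H; elim: s => [|i s IH].
  by apply: (polyf_ext _ (polyf_const 0)) => v; rewrite big_nil.
case Pi: (P i); last by apply: (polyf_ext _ IH) => v; rewrite big_cons Pi.
by apply: (polyf_ext _ (polyf_add (H i) IH)) => v; rewrite big_cons Pi.
Qed.

Lemma polyf_prod (T : Type) (s : seq T) (P : pred T) (h : T -> 'rV[K]_n -> K) :
  (forall i, polyf (h i)) -> polyf (fun v => \prod_(i <- s | P i) h i v).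
Proof.
move=> H; elim: s => [|i s IH].
  by apply: (polyf_ext _ (polyf_const 1)) => v; rewrite big_nil.
case Pi: (P i); last by apply: (polyf_ext _ IH) => v; rewrite big_cons Pi.
by apply: (polyf_ext _ (polyf_mul (H i) IH)) => v; rewrite big_cons Pi.
Qed.

Definition polymx p q (A : 'rV[K]_n -> 'M[K]_(p, q)) :=
  forall i j, polyf (fun v => A v i j).

Lemma polymx_const p q (A : 'M[K]_(p, q)) : polymx (fun=> A).
Proof. by move=> i j; apply: polyf_const. Qed.

Lemma polymx_add p q (A B : 'rV[K]_n -> 'M[K]_(p, q)) :
  polymx A -> polymx B -> polymx (fun v => A v + B v).
Proof.
move=> hA hB i j; apply: (polyf_ext _ (polyf_add (hA i j) (hB i j))) => v.
by rewrite mxE.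
Qed.

Lemma polymx_opp p q (A : 'rV[K]_n -> 'M[K]_(p, q)) :
  polymx A -> polymx (fun v => - A v).
Proof.
by move=> hA i j; apply: (polyf_ext _ (polyf_opp (hA i j))) => v; rewrite mxE.
Qed.

Lemma polymx_mul p q r (A : 'rV[K]_n -> 'M[K]_(p, q))
    (B : 'rV[K]_n -> 'M[K]_(q, r)) :
  polymx A -> polymx B -> polymx (fun v => A v *m B v).
Proof.
move=> hA hB i j.
have H (k : 'I_q) : polyf (fun v => A v i k * B v k j) by exact: polyf_mul.
by apply: (polyf_ext _ (polyf_sum (index_enum 'I_q) predT H)) => v; rewrite mxE.
Qed.

Lemma polyf_det p (A : 'rV[K]_n -> 'M[K]_p) :
  polymx A -> polyf (fun v => \det (A v)).
Proof.
move=> hA; apply: polyf_sum => s; apply: polyf_mul; first exact: polyf_const.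
by apply: polyf_prod => i; apply: hA.
Qed.

End PolyFun.

(** * Irreducible closed sets, chains and Hilbert functions *)

Section AG.
Variables (K : closedFieldType) (N : nat).
Implicit Types (Z X : 'rV[K]_N -> Prop) (f g : {mpoly K[N]}).

(** The zero sets of [f] and [g] form a closed cover of [Z]. *)
Lemma irr_prime Z f g : irr_closed Z ->
  (forall x, Z x -> f.@[x 0] * g.@[x 0] = 0) ->
  (forall x, Z x -> f.@[x 0] = 0) \/ (forall x, Z x -> g.@[x 0] = 0).
Proof.
have cl h : zclosed (fun x : 'rV[K]_N => h.@[x 0] = 0).
  by exists (fun k => k = h) => x; split=> [e k -> //|]; apply.
move=> [_ [_ irr]] H; case: (irr _ _ (cl f) (cl g)) => [x /H /eqP|s|s].
- by rewrite mulf_eq0 => /orP[/eqP|/eqP]; [left|right].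
- by left.
- by right.
Qed.

Definition indep_on Z (T : finType) (w : T -> {mpoly K[N]}) :=
  forall c : T -> K, (forall x, Z x -> \sum_i c i * (w i).@[x 0] = 0) ->
  forall i, c i = 0.

(** If [g] vanishes on [Z] but not identically on [Z'], the powers of [g] are
    independent over the functions that are independent on [Z]: in a relation on
    [Z'], divide by the lowest power of [g] that occurs, which [irr_prime] allows,
    and restrict to [Z] to see that its coefficients vanish. *)
Lemma indep_step Z Z' (g : {mpoly K[N]}) (s : nat) (T : finType)
    (w : T -> {mpoly K[N]}) :
  irr_closed Z' -> Defs.subset Z Z' -> (forall x, Z x -> g.@[x 0] = 0) ->
  (exists2 x, Z' x & g.@[x 0] != 0) -> indep_on Z w ->
  indep_on Z' (fun u : 'I_s * T => g ^+ u.1 * w u.2).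
Proof.
move=> irr sub gZ [x0 Zx0 gx0] ind c Hc.
suff H j : forall (lt : (j < s)%N) i, c (Ordinal lt, i) = 0.
  by move=> [[j lt] i]; apply: H.
elim/ltn_ind: j => j IH lt.
(* the relation divided by the power g ^+ j *)
pose R := \sum_(j' < s | (j <= j')%N) \sum_i c (j', i) *: (g ^+ (j' - j) * w i).
have HR x : Z' x -> (g ^+ j).@[x 0] * R.@[x 0] = 0.
  move=> Zx; rewrite -[RHS](Hc x Zx).
  transitivity (\sum_(j < s) \sum_i c (j, i) * (g ^+ j * w i).@[x 0]); last first.
    by rewrite pair_bigA; apply: eq_bigr => -[].
  rewrite [RHS](bigID (fun j' : 'I_s => (j <= j')%N)) /= [X in _ = _ + X]big1 ?addr0; last first.
    move=> j'; rewrite -ltnNge => lj; rewrite big1 // => i _.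
    by case: j' lj => j' l' lj; rewrite (IH _ lj l') mul0r.
  rewrite raddf_sum big_distrr; apply: eq_bigr => j' le; rewrite raddf_sum big_distrr.
  apply: eq_bigr => i _ /=; rewrite mevalZ mulrCA -mevalM mulrA.
  by rewrite -exprD subnKC.
case: (irr_prime irr HR) => [/(_ _ Zx0)/eqP|{}HR].
  by rewrite rmorphXn expf_eq0 (negPf gx0) andbF.
move=> i; apply: (ind (fun i => c (Ordinal lt, i))) => x Zx.
have := HR x (sub _ Zx); rewrite raddf_sum (bigD1 (Ordinal lt)) //= [X in _ + X]big1 ?addr0.
  move=> e; rewrite -[RHS]e raddf_sum; apply: eq_bigr => k _.
  by rewrite /= subnn expr0 mul1r mevalZ.
move=> j' /andP[le ne]; rewrite raddf_sum big1 // => k _ /=.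
rewrite mevalZ mevalM rmorphXn /= gZ // expr0n subn_eq0 leqNgt ltn_neqAle le andbT.
by rewrite eq_sym in ne; rewrite [(j : nat) == j'](negPf ne) mul0r mulr0.
Qed.

Lemma msizeM_bound (n : nat) (f g : {mpoly K[n]}) d e :
  (msize f <= d.+1 -> msize g <= e.+1 -> msize (f * g) <= (d + e).+1)%N.
Proof.
move=> hf hg; have [->|f0] := eqVneq f 0; first by rewrite mul0r msize0.
have [->|g0] := eqVneq g 0; first by rewrite mulr0 msize0.
by rewrite msizeM // -subn1 leq_subLR add1n -addSn -addnS leq_add.
Qed.

Lemma msizeX_bound (n : nat) (f : {mpoly K[n]}) d k :
  (msize f <= d.+1 -> msize (f ^+ k) <= (d * k).+1)%N.
Proof.
move=> hf; elim: k => [|k IH]; first by rewrite expr0 msize1 muln0.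
by rewrite exprS mulnS; apply: msizeM_bound.
Qed.

(** A Hilbert-function form of the statement that a chain of length [m] produces
    [m] algebraically independent functions: each step of the chain contributes one
    polynomial [g] and multiplies the number of independent products by [s]. *)
Lemma chain_indep m (F : nat -> 'rV[K]_N -> Prop) :
  (forall i, (i <= m)%N -> irr_closed (F i)) ->
  (forall i, (i < m)%N -> Defs.subset (F i) (F i.+1) /\ ~ Defs.subset (F i.+1) (F i)) ->
  exists E, forall s, exists (T : finType) (w : T -> {mpoly K[N]}),
    [/\ #|T| = (s ^ m)%N, forall i, (msize (w i) <= (E * s).+1)%N
      & indep_on (F m) w].
Proof.
elim: m => [|m IH] irr inc.
  exists 0%N => s; exists unit, (fun=> 1); split=> [|i|c Hc []].
  - by rewrite card_unit.
  - by rewrite msize1.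
  have [_ [[x Fx] _]] := irr 0%N isT.
  by have := Hc x Fx; rewrite (big_pred1 tt) ?meval1 ?mulr1 // => -[].
have [E HE] := IH (fun i h => irr i (leqW h)) (fun i h => inc i (leqW h)).
have [sub nsub] := inc m (ltnSn m).
have [x Fx nFx] : exists2 x, F m.+1 x & ~ F m x.
  by apply: NNPP => H; apply: nsub => x Fx; apply: NNPP => h; apply: H; exists x.
have [[J HJ] _] := irr m (leqnSn m).
have [g Jg gx] : exists2 g, J g & g.@[x 0] <> 0.
  by apply: NNPP => H; apply: nFx; apply/HJ => f Jf; apply: NNPP => h; apply: H; exists f.
exists (msize g + E)%N => s; have [T [w [cT sw indw]]] := HE s.
exists ('I_s * T)%type, (fun u : 'I_s * T => g ^+ u.1 * w u.2); split.
- by rewrite card_prod card_ord cT expnS.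
- move=> [j i] /=; rewrite mulnDl; apply: msizeM_bound (sw i).
  apply: leq_trans (msizeX_bound j (leqnSn _)) _.
  by rewrite ltnS leq_mul2l (ltnW (ltn_ord j)) orbT.
apply: indep_step (sub) _ _ indw; first exact: irr.
  by move=> y /HJ; apply.
by exists x => //; apply/eqP.
Qed.

End AG.

Section Count.
Variables (K : closedFieldType).

(** Polynomials of degree below [B] in [D] variables have all exponents below [B],
    so they span a space of dimension at most [B ^ D]. *)
Lemma card_indep_mpoly D (B : nat) (T : finType) (u : T -> {mpoly K[D]}) :
  (forall i, msize (u i) <= B)%N ->
  (forall c : T -> K, \sum_i c i *: u i = 0 -> forall i, c i = 0) ->
  (#|T| <= B ^ D)%N.
Proof.
move=> su ind; apply: (@leq_trans #|{: 'X_{1..D < B}}|); last first.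
  have -> : (B ^ D)%N = #|{ffun 'I_D -> 'I_B}| by rewrite card_ffun !card_ord.
  have lt (m : 'X_{1..D < B}) i : (m i < B)%N.
    by apply: leq_ltn_trans (bmdeg m); rewrite mdegE (bigD1 i) //= leq_addr.
  pose h (m : 'X_{1..D < B}) := [ffun i => Ordinal (lt m i)].
  have : injective h.
    move=> m1 m2 /ffunP e; apply/val_inj/mnmP => i; have := e i; rewrite !ffunE.
    by move/(congr1 val).
  exact: leq_card.
pose A : 'M[K]_(#|T|, #|{: 'X_{1..D < B}}|) :=
  \matrix_(i, j) (u (enum_val i))@_(enum_val j : 'X_{1..D < B}).
suff /eqP <- : row_free A by exact: rank_leq_col.
apply: inj_row_free => v Av; apply/rowP => i; rewrite mxE -(enum_valK i).
move: (enum_val i); apply: (ind (fun t => v 0 (enum_rank t))) => //.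
rewrite (eq_bigr (fun t => \sum_(m : 'X_{1..D < B}) (v 0 (enum_rank t) * (u t)@_m) *: 'X_[m]));
  last first.
  by move=> t _; rewrite {1}(mpolywE (su t)) scaler_sumr; apply: eq_bigr => m _; rewrite scalerA.
rewrite exchange_big big1 // => m _; rewrite -scaler_suml.
suff -> : \sum_t v 0 (enum_rank t) * (u t)@_m = 0 by rewrite scale0r.
move/rowP/(_ (enum_rank m)): Av; rewrite !mxE => e; rewrite -[RHS]e.
rewrite (reindex (fun k : 'I_#|T| => enum_val k)) /=; last exact/onW_bij/enum_val_bij.
by apply: eq_bigr => k _; rewrite !mxE enum_valK enum_rankK.
Qed.

Lemma msize_comp_bound N D (Phi : N.-tuple {mpoly K[D]}) e (f : {mpoly K[N]}) d :
  (forall k, msize (tnth Phi k) <= e.+1)%N -> (msize f <= d.+1)%N ->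
  (msize (f \mPo Phi) <= (e * d).+1)%N.
Proof.
move=> hP hf; rewrite (comp_mpolywE Phi hf).
apply: leq_trans (mmeasure_sum _ _ _ _) _; apply/bigmax_leqP => m _.
apply: leq_trans (mmeasureZ_le _ _ _) _.
have md : (mdeg m <= d)%N by rewrite -ltnS; apply: bmdeg.
apply: (@leq_trans (e * mdeg m).+1); last by rewrite ltnS leq_mul2l md orbT.
rewrite mdegE; elim: (index_enum _) => [|k s IH]; first by rewrite !big_nil msize1.
by rewrite !big_cons mulnDr; apply: msizeM_bound IH; apply: msizeX_bound.
Qed.

End Count.

Section Chains.
Variables (K : closedFieldType) (N D : nat).
Implicit Types (Z X : 'rV[K]_N -> Prop).

Lemma polymx_tuple (phi : 'rV[K]_D -> 'rV[K]_N) : polymx phi ->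
  exists Phi : N.-tuple {mpoly K[D]}, forall p k, phi p 0 k = (tnth Phi k).@[p 0].
Proof.
move=> H; have [Phi HPhi] := fin_all_exists (H 0).
by exists [tuple Phi k | k < N] => p k; rewrite tnth_mktuple HPhi.
Qed.

Lemma comp_polymx (Phi : N.-tuple {mpoly K[D]}) (phi : 'rV[K]_D -> 'rV[K]_N) f (p : 'rV[K]_D) :
  (forall (p : 'rV[K]_D) k, phi p 0 k = (tnth Phi k).@[p 0]) ->
  (f \mPo Phi).@[p 0] = f.@[phi p 0].
Proof. by move=> H; rewrite comp_mpoly_meval; apply: meval_eq => k; rewrite H. Qed.

(** Compare both sides at [s = (a + 1)^D + 1]. *)
Lemma pow_growth m a : (forall s, s ^ m <= (a * s).+1 ^ D)%N -> (m <= D)%N.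
Proof.
move=> H; rewrite leqNgt; apply/negP => lt; pose s := (a.+1 ^ D).+1.
have le1 : (s ^ D.+1 <= s ^ m)%N by rewrite leq_pexp2l.
have le2 : ((a * s).+1 ^ D <= (a.+1 * s) ^ D)%N.
  have [->|D0] := posnP D; first by rewrite !expn0.
  by rewrite leq_exp2r // mulSn -[X in (X <= _)%N]add1n leq_add2r.
have := leq_trans le1 (leq_trans (H s) le2).
by rewrite expnMn expnS leq_pmul2r ?expn_gt0 // ltnn.
Qed.

(** The upper bound for dimensions: on the dense open part [q != 0] of [Z] the
    functions of [chain_indep] pull back along [phi] to linearly independent
    polynomials in [D] variables whose degrees grow linearly in [s]. *)
Lemma chain_length_le Z m (phi : 'rV[K]_D -> 'rV[K]_N) (q : 'rV[K]_N -> K) :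
  irr_closed Z -> irr_chain Z m -> polymx phi -> polyf q ->
  (exists2 x, Z x & q x != 0) ->
  (forall x, Z x -> q x != 0 -> exists p, x = phi p) -> (m <= D)%N.
Proof.
move=> irrZ [F [FZ Finc]] /polymx_tuple[Phi HPhi] [g Hg] [x0 Zx0 qx0] im.
have [E HE] := chain_indep (fun i h => (FZ i h).1) Finc.
pose e := \max_k msize (tnth Phi k).
apply: (@pow_growth _ (e * E)) => s; have [T [w [<- sw indw]]] := HE s.
apply: (@card_indep_mpoly _ _ _ _ (fun i => w i \mPo Phi)) => [i|c Hc].
  rewrite -mulnA; apply: msize_comp_bound (sw i) => k.
  by apply: leqW; apply: (leq_bigmax k).
apply: indw; suff H x : Z x -> \sum_i c i * (w i).@[x 0] = 0.
  by move=> x Fx; apply: H; apply: (FZ m (leqnn m)).2.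
have Hw y : (\sum_i c i *: w i).@[y 0] = \sum_i c i * (w i).@[y 0].
  by rewrite raddf_sum; apply: eq_bigr => i _; rewrite /= mevalZ.
move=> Zx; rewrite -Hw; case: (@irr_prime _ _ Z (\sum_i c i *: w i) g irrZ) => [y Zy|->//|].
  have [gy|gy] := eqVneq (g.@[y 0]) 0; first by rewrite gy mulr0.
  rewrite -Hg in gy; have [p ->] := im y Zy gy.
  rewrite -(comp_polymx _ _ HPhi).
  have -> : (\sum_i c i *: w i) \mPo Phi = 0; last by rewrite meval0 mul0r.
  by rewrite -[RHS]Hc raddf_sum; apply: eq_bigr => i _; rewrite /= comp_mpolyZ.
by move/(_ _ Zx0)/eqP; rewrite -Hg (negPf qx0).
Qed.

Definition closure_of (S : 'rV[K]_N -> Prop) (x : 'rV[K]_N) : Prop :=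
  forall f : {mpoly K[N]}, (forall y, S y -> f.@[y 0] = 0) -> f.@[x 0] = 0.

Lemma closure_sub (S : 'rV[K]_N -> Prop) x : S x -> closure_of S x.
Proof. by move=> Sx f; apply. Qed.

Lemma closure_min (S : 'rV[K]_N -> Prop) Z : zclosed Z -> Defs.subset S Z ->
  Defs.subset (closure_of S) Z.
Proof.
move=> [J HJ] SZ x cx; apply/HJ => f Jf; apply: cx => y /SZ /HJ; exact.
Qed.

Lemma closure_closed S : zclosed (closure_of S).
Proof.
exists (fun f => forall y, S y -> f.@[y 0] = 0) => x.
by split=> H f; apply: H.
Qed.

Lemma mpoly_line (f : {mpoly K[D]}) (p q : 'rV[K]_D) :
  exists u : {poly K}, forall t, u.[t] = f.@[(p + t *: (q - p)) 0].
Proof.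
exists (mmap polyC (fun k => (p 0 k)%:P + (q 0 k - p 0 k) *: 'X) f) => t.
rewrite /mmap horner_sum mevalE; apply: eq_bigr => m _.
rewrite hornerM hornerC; congr (_ * _); rewrite /mmap1 horner_prod.
by apply: eq_bigr => k _; rewrite horner_exp !hornerE !mxE mulrC.
Qed.

(** Two nonzero functions on the image stay nonzero on the line joining two points
    of the parameter space where they do not vanish; their product, a nonzero
    polynomial in one variable over an infinite field, does not vanish on that line. *)
Lemma irr_closure_image (phi : 'rV[K]_D -> 'rV[K]_N) (A : 'rV[K]_D -> Prop) :
  polymx phi -> (exists p, A p) ->
  (forall p q t, A p -> A q -> A (p + t *: (q - p))) ->
  irr_closed (closure_of (fun x => exists2 p, A p & x = phi p)).
Proof.
move=> /polymx_tuple[Phi HPhi] [p0 Ap0] lin.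
split; first exact: closure_closed.
split; first by exists (phi p0); apply: closure_sub; exists p0.
move=> Z1 Z2 cl1 cl2 cov.
have [s1|n1] := classic (Defs.subset (fun x => exists2 p, A p & x = phi p) Z1).
  by left; apply: closure_min.
have [s2|n2] := classic (Defs.subset (fun x => exists2 p, A p & x = phi p) Z2).
  by right; apply: closure_min.
have wit Z : zclosed Z -> ~ Defs.subset (fun x => exists2 p, A p & x = phi p) Z ->
    exists (f : {mpoly K[N]}) p, [/\ A p, forall x, Z x -> f.@[x 0] = 0 & f.@[phi p 0] <> 0].
  move=> [J HJ] n; apply: NNPP => H; apply: n => _ [p Ap ->]; apply/HJ => f Jf.
  by apply: NNPP => nf; apply: H; exists f, p; split=> // x /HJ; apply.
have [f1 [p1 [A1 z1 v1]]] := wit _ cl1 n1; have [f2 [p2 [A2 z2 v2]]] := wit _ cl2 n2.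
have [u1 Hu1] := mpoly_line (f1 \mPo Phi) p1 p2.
have [u2 Hu2] := mpoly_line (f2 \mPo Phi) p1 p2.
have nz : u1 * u2 != 0.
  rewrite mulf_eq0; apply/norP; split; apply/eqP => u0.
    by apply: v1; have := Hu1 0; rewrite u0 horner0 scale0r addr0 (comp_polymx _ _ HPhi).
  apply: v2; have := Hu2 1; rewrite u0 horner0 scale1r addrC subrK.
  by rewrite (comp_polymx _ _ HPhi).
have [t /negP[]] := closed_nonrootP _ nz; apply/rootP; rewrite hornerM Hu1 Hu2 !(comp_polymx _ _
  HPhi).
have /cov[/z1->|/z2->] : closure_of (fun x => exists2 p, A p & x = phi p) (phi (p1 + t *: (p2 -
  p1))).
- by apply: closure_sub; exists (p1 + t *: (p2 - p1)); first exact: lin.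
- by rewrite mul0r.
- by rewrite mulr0.
Qed.

(** The lower bound for dimensions. Freeing the parameters in the order of the list
    [L], starting from the base point [b], gives a chain. It is strict at the step
    freeing [k] because the function [G k] then still reads off the parameter [k]: it
    is constant on the smaller image and not on the larger one. *)
Lemma image_chain (phi : 'rV[K]_D -> 'rV[K]_N) (G : 'I_D -> 'rV[K]_N -> K)
    (b : 'rV[K]_D) (L : seq 'I_D) :
  polymx phi -> (forall k, polyf (G k)) -> uniq L ->
  (forall k (p : 'rV[K]_D),
     (forall j, (index k L < index j L)%N -> p 0 j = b 0 j) -> G k (phi p) = p 0 k) ->
  irr_chain (closure_of (fun x => exists2 p, True & x = phi p)) (size L).
Proof.
move=> pphi pG uL HG.
pose A i (p : 'rV[K]_D) := forall j, j \notin take i L -> p 0 j = b 0 j.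
exists (fun i => closure_of (fun x => exists2 p, A i p & x = phi p)); split.
  move=> i _; split.
    apply: irr_closure_image => //; first by exists b.
    by move=> p q t Ap Aq j nj; rewrite !mxE Ap // Aq // subrr mulr0 addr0.
  move=> x; apply: closure_min; first exact: closure_closed.
  by move=> _ [p _ ->]; apply: closure_sub; exists p.
move=> i lt; have [k1 _] : exists k1 : 'I_D, True by case: (L) lt => // k1; exists k1.
pose k := nth k1 L i.
have tS : take i.+1 L = rcons (take i L) k by rewrite -take_nth.
have HGi p : A i.+1 p -> G k (phi p) = p 0 k.
  move=> Ap; apply: HG => j; rewrite index_uniq // => lj; apply: Ap.
  by apply/negP => /index_ltn; rewrite ltnS leqNgt lj.
have sub p : A i p -> A i.+1 p.
  by move=> Ap j; rewrite tS mem_rcons inE negb_or => /andP[_]; apply: Ap.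
have nk : k \notin take i L.
  by have := take_uniq i.+1 uL; rewrite tS rcons_uniq => /andP[].
split.
  move=> x; apply: closure_min; first exact: closure_closed.
  by move=> _ [p Ap ->]; apply: closure_sub; exists p => //; apply: sub.
move=> /(_ (phi (b + delta_mx 0 k))) H.
have Ab : A i.+1 (b + delta_mx 0 k).
  move=> j; rewrite tS mem_rcons inE negb_or => /andP[/negPf nj _].
  by rewrite !mxE nj andbF addr0.
have [g Hg] := pG k.
have : (g - (b 0 k)%:MP).@[phi (b + delta_mx 0 k) 0] = 0.
  apply: H; first by apply: closure_sub; exists (b + delta_mx 0 k).
  by move=> _ [p Ap ->]; rewrite mevalB mevalC -Hg HGi ?(Ap k) ?subrr //; apply: sub.
rewrite mevalB mevalC -Hg HGi // => /eqP.
by rewrite !mxE !eqxx addrAC subrr add0r oner_eq0.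
Qed.

End Chains.

(** * Truncated identities, flips and adapted bases *)

Section LeadFlip.
Variables (K : fieldType) (n : nat).
Implicit Types (A B : 'M[K]_n).

Definition lead_proj k : 'M[K]_n := pid_mx k.
(** The reversal of the first [d] coordinates. All matrices are padded to size [n],
    and the matrix of an arrow [a] is stored with its columns reversed, so that a
    matrix of rank [r] has the normal form [lead_proj r] and the relation [a b = 0]
    reads [F a *m flip_mx *m F b = 0]. *)
Definition flip_mx d : 'M[K]_n := \matrix_(i, j) ((i + j).+1 == d)%:R.
Local Notation P := lead_proj.
Local Notation W := flip_mx.

Lemma mulPl k A i j : (P k *m A) i j = if (i < k)%N then A i j else 0.
Proof.
rewrite mxE (bigD1 i) //= big1 ?addr0 => [|l ne]; rewrite mxE.
  by rewrite eqxx /=; case: ltnP; rewrite ?mul1r ?mul0r.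
by rewrite [(i : nat) == l]eq_sym [(l : nat) == i](negPf ne) mul0r.
Qed.

Lemma mulPr k A i j : (A *m P k) i j = if (j < k)%N then A i j else 0.
Proof.
rewrite mxE (bigD1 j) //= big1 ?addr0 => [|l ne]; rewrite mxE.
  by rewrite eqxx /=; case: ltnP; rewrite ?mulr1 ?mulr0.
by rewrite [(l : nat) == j](negPf ne) mulr0.
Qed.

Lemma PE k i j : P k i j = ((i == j) && (i < k)%N)%:R.
Proof. by rewrite mxE. Qed.

Lemma PP a b : P a *m P b = P (minn a b).
Proof.
by apply/matrixP=> i j; rewrite mulPl !PE leq_min; case: ltnP; rewrite ?andbF.
Qed.

Lemma PPl a b : (a <= b)%N -> P a *m P b = P a.
Proof. by rewrite PP => /minn_idPl->. Qed.

Lemma PPr a b : (b <= a)%N -> P a *m P b = P b.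
Proof. by rewrite PP => /minn_idPr->. Qed.

Lemma PW d : P d *m W d = W d.
Proof.
apply/matrixP=> i j; rewrite mulPl mxE; case: ltnP => // h.
by case: eqP => // e; lia.
Qed.

Lemma WP d : W d *m P d = W d.
Proof.
apply/matrixP=> i j; rewrite mulPr mxE; case: ltnP => // h.
by case: eqP => // e; lia.
Qed.

(** An initial and a final segment of [d] coordinates that do not overlap. *)
Lemma PWP a b d : (a + b <= d)%N -> P a *m W d *m P b = 0.
Proof.
move=> le; apply/matrixP=> i j; rewrite mulPr mulPl !mxE.
by case: ltnP => // h1; case: ltnP => // h2; case: eqP => // e; lia.
Qed.

Lemma WPW k d : (k <= d)%N -> (d <= n)%N -> W d *m P k *m W d = P d - P (d - k)%N.
Proof.
move=> kd dn; apply/matrixP=> i j; rewrite !mxE.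
case: (ltnP i d) => id; last first.
  rewrite big1 => [|l _].
    by rewrite [(i < d - k)%N]ltnNge (leq_trans (leq_subr k d) id) /= !andbF subrr.
  by rewrite mulPr !mxE; case: ltnP; case: eqP => e; rewrite ?mul0r //; lia.
have lt : (d - i.+1 < n)%N by lia.
rewrite (bigD1 (Ordinal lt)) //= big1 => [|l ne].
  rewrite mulPr !mxE /=.
  have -> : ((i + (d - i.+1)).+1 == d) = true by apply/eqP; lia.
  have -> : (((d - i.+1) + j).+1 == d) = (i == j :> nat) by apply/eqP/eqP; lia.
  have -> : (d - i.+1 < k)%N = ~~ (i < d - k)%N by lia.
  case: eqP => _; case: ltnP => _; rewrite /= ?mulr0 ?mul0r ?mulr1 ?mul1r ?subr0 ?addr0 ?subrr //.
rewrite mulPr !mxE; case: eqP => [e|_]; last by case: ltnP; rewrite mul0r.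
by case/eqP: ne; apply: val_inj => /=; lia.
Qed.

Lemma WW d : (d <= n)%N -> W d *m W d = P d.
Proof.
move=> dn; rewrite -{1}(WP d) WPW // subnn.
suff -> : P 0 = 0 by rewrite subr0.
exact: pid_mx_0.
Qed.

Lemma P0 : P 0 = 0. Proof. exact: pid_mx_0. Qed.

Lemma rankP k : (k <= n)%N -> \rank (P k) = k.
Proof. by move=> h; apply: rank_pid_mx. Qed.

Lemma rankP_le k : (\rank (P k) <= k)%N.
Proof.
have [h|h] := leqP k n; first by rewrite rankP.
exact: leq_trans (rank_leq_row _) (ltnW h).
Qed.

Lemma rank_mulP k A B : A = B *m P k -> (\rank A <= k)%N.
Proof. move=> ->; exact: leq_trans (mxrankM_maxr _ _) (rankP_le k). Qed.

Lemma rank_mul0_le d A B : (d <= n)%N -> A *m P d = A -> P d *m B = B ->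
  A *m B = 0 -> (\rank A + \rank B <= d)%N.
Proof.
move=> dn hA hB AB.
pose A1 := A *m (pid_mx d : 'M_(n, d)); pose B1 := (pid_mx d : 'M_(d, n)) *m B.
have pp : (pid_mx d : 'M[K]_(n, d)) *m (pid_mx d : 'M_(d, n)) = P d.
  by rewrite pid_mx_id.
have eA : A = A1 *m (pid_mx d : 'M_(d, n)) by rewrite -mulmxA pp.
have eB : B = (pid_mx d : 'M_(n, d)) *m B1 by rewrite mulmxA pp.
have : A1 *m B1 = 0 by rewrite /A1 /B1 mulmxA -(mulmxA A) pp hA.
move/mulmx0_rank_max; apply: leq_trans; apply: leq_add.
  by rewrite {1}eA mxrankM_maxl.
by rewrite {1}eB mxrankM_maxr.
Qed.

(** A rank factorization of an idempotent is automatically a dual pair: cancel the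
    outer factors in [A A = A]. *)
Lemma idem_factor A : A *m A = A ->
  exists L R, [/\ A = L *m P (\rank A) *m R & P (\rank A) *m R *m L *m P (\rank A) = P (\rank A)].
Proof.
move=> id; exists (col_ebase A), (row_ebase A); rewrite /lead_proj mulmx_ebase; split=> //.
have uL : col_ebase A \in unitmx by apply: col_ebase_unit.
have uR : row_ebase A \in unitmx by apply: row_ebase_unit.
have := id; rewrite -{1 2 3}(mulmx_ebase A) => /(congr1 (fun X =>
  invmx (col_ebase A) *m X *m invmx (row_ebase A))).
by rewrite !mulmxA mulVmx // mul1mx !mulmxK // -!mulmxA.
Qed.

Lemma rank_factor (F : 'M[K]_n) t s :
  P t *m F = F -> F *m P s = F -> let r := \rank F in
  exists U U' V V', [/\ F = U *m V,
    [/\ P t *m U = U, U *m P r = U, U' *m U = P r, U' *m P t = U' & P r *m U' = U']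
  & [/\ V *m P s = V, P r *m V = V, V *m V' = P r, P s *m V' = V' & V' *m P r = V']].
Proof.
move=> hl hr r; pose L := col_ebase F; pose R := row_ebase F.
have uL : L \in unitmx by apply: col_ebase_unit.
have uR : R \in unitmx by apply: row_ebase_unit.
have eF : L *m P r *m R = F by apply: mulmx_ebase.
have hU : P t *m (L *m P r) = L *m P r.
  by have := hl; rewrite -eF mulmxA => /(congr1 (mulmx^~ (invmx R))); rewrite !mulmxK.
have hV : P r *m R *m P s = P r *m R.
  have := hr; rewrite -eF -!mulmxA => /(congr1 (mulmx (invmx L))).
  by rewrite !mulKmx.
have rr : P r *m P r = P r by rewrite PPl.
exists (L *m P r), (P r *m invmx L *m P t), (P r *m R), (P s *m invmx R *m P r); split.
- by rewrite mulmxA -(mulmxA L) rr eF.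
- split=> //; first by rewrite -mulmxA rr.
  + by rewrite -mulmxA hU mulmxA -(mulmxA (P r)) mulVmx // mulmx1 rr.
  + by rewrite -mulmxA PPl.
  + by rewrite !mulmxA rr.
- split=> //; first by rewrite mulmxA rr.
  + by rewrite !mulmxA hV -(mulmxA (P r)) mulmxV // mulmx1 rr.
  + by rewrite !mulmxA PPl.
  + by rewrite -mulmxA rr.
Qed.

(** A basis of the space of dimension [d] between two composable maps: [U] is a
    basis of the image of the incoming map, and [X] is the outgoing map written in a
    basis of its image. The basis [g] starts with [U] and ends with vectors on which
    [X] is the (reversed) identity. It completes [U] and a section [Y] of [X] by a
    basis of the range of the complementary idempotent [E], the homology. *)
Lemma adapted_basis d ra rb (U U0 X Y : 'M[K]_n) : (d <= n)%N -> (ra + rb <= d)%N ->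
  [/\ P d *m U = U, U *m P rb = U, U0 *m U = P rb, U0 *m P d = U0 & P rb *m U0 = U0] ->
  [/\ X *m P d = X, P ra *m X = X, X *m Y = P ra, P d *m Y = Y & Y *m P ra = Y] ->
  X *m U = 0 ->
  exists g g', [/\ [/\ g *m g' = P d, g' *m g = P d, P d *m g = g & g *m P d = g],
     P d *m g' = g' /\ g' *m P d = g',
     g *m P rb = U & X *m g = P ra *m W d].
Proof.
move=> dn le [dU Ub U0U U0d bU0] [Xd aX XY dY Ya] XU.
have le1 : (rb <= d - ra)%N by lia.
have le2 : (d - ra <= n)%N by lia.
(* the left inverse U0 of U is corrected so as to kill the section Y *)
pose h := (d - ra - rb)%N; pose U' := U0 - U0 *m Y *m X.
have U'U : U' *m U = P rb by rewrite mulmxBl -!mulmxA XU !mulmx0 subr0.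
have U'Y : U' *m Y = 0 by rewrite mulmxBl -!mulmxA XY Ya subrr.
have U'd : U' *m P d = U' by rewrite /U' mulmxBl U0d -(mulmxA _ X) Xd.
have bU' : P rb *m U' = U' by rewrite mulmxBr !mulmxA bU0.
clearbody U'.
(* the projection onto the homology, of rank h *)
have [E defE] : {E | E = P d - U *m U' - Y *m X} by eexists.
have XE : X *m E = 0 by rewrite defE !mulmxBr Xd !mulmxA XU mul0mx subr0 XY aX subrr.
have EU : E *m U = 0 by rewrite defE !mulmxBl dU -!mulmxA U'U Ub XU mulmx0 subr0 subrr.
have U'E : U' *m E = 0 by rewrite defE !mulmxBr U'd !mulmxA U'U U'Y mul0mx subr0 bU' subrr.
have EY : E *m Y = 0 by rewrite defE !mulmxBl dY -!mulmxA U'Y mulmx0 subr0 XY Ya subrr.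
have Ed : E *m P d = E by rewrite defE !mulmxBl PPl // -!mulmxA U'd Xd.
have EE : E *m E = E.
  by rewrite {2}defE !mulmxBr Ed !mulmxA EU EY !mul0mx !subr0.
have [Q defQ] : {Q | Q = P (d - ra)%N - P rb} by eexists.
pose w := W (d - ra)%N.
have wPw : w *m P h *m w = Q.
  rewrite defQ /w /h WPW ?leq_subr //; congr (P _ - P _); lia.
have rE : \rank E = h.
  apply/eqP; rewrite eqn_leq; apply/andP; split; last first.
    have : (\rank (P d) <= ra + rb + \rank E)%N.
      have -> : P d = Y *m X + U *m U' + E by rewrite [RHS]addrC addrA defE !subrK.
      apply: leq_trans (mxrank_add _ _) _; rewrite leq_add2r.
      apply: leq_trans (mxrank_add _ _) _; apply: leq_add.
        by rewrite -Ya; apply: leq_trans (mxrankM_maxl _ _) _; apply: rank_mulP erefl.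
      by rewrite -Ub; apply: leq_trans (mxrankM_maxl _ _) _; apply: rank_mulP erefl.
    by rewrite rankP // /h; lia.
  have [c defc] : {c | c = 1%:M - P d} by eexists.
  have cA A : P d *m A = A -> c *m A = 0 by move=> dA; rewrite defc mulmxBl mul1mx dA subrr.
  have Ac A : A *m P d = A -> A *m c = 0 by move=> dA; rewrite defc mulmxBr mulmx1 dA subrr.
  have cc : c *m c = c by rewrite {2}defc mulmxBr mulmx1 defc mulmxBl PPl // mul1mx subrr subr0.
  have EN : E *m (U + Y *m W d + c) = 0 by rewrite !mulmxDr EU mulmxA EY mul0mx (Ac _ Ed) !addr0.
  have MN : (U' + W d *m X + c) *m (U + Y *m W d + c) = 1%:M - Q.
    rewrite !mulmxDl !mulmxDr (Ac _ U'd) (cA _ dU) cc (mulmxA U') U'Y mul0mx U'U.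
    rewrite (mulmxA c) (cA _ dY) mul0mx -!(mulmxA (W d)) XU (Ac _ Xd) !mulmx0 (mulmxA X) XY
      mulmxA WPW //; last by lia.
    by rewrite !addr0 !add0r defc defQ opprB -addrA (addrC _ (1%:M - _)) (addrA (1%:M - _)) subrK
      addrCA.
  have rN : (\rank E + \rank (U + Y *m W d + c)%R <= n)%N by apply: mulmx0_rank_max.
  have rQ : (\rank Q <= h)%N.
    by rewrite -wPw; apply: leq_trans (mxrankM_maxl _ _) _; apply: rank_mulP erefl.
  have r1 : (n <= \rank ((U' + W d *m X + c) *m (U + Y *m W d + c)) + \rank Q)%N.
    rewrite -[X in (X <= _)%N](mxrank1 K n) -{1}(subrK Q 1%:M) MN; exact: mxrank_add.
  have := mxrankM_maxr (U' + W d *m X + c) (U + Y *m W d + c); lia.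
have [L [R [eE eP]]] := idem_factor EE; rewrite rE in eE eP.
have [U3 defU3] : {U3 | U3 = L *m P h *m w} by eexists.
have [V3 defV3] : {V3 | V3 = w *m P h *m R} by eexists.
have U3V3 : U3 *m V3 = E.
  by rewrite defU3 defV3 !mulmxA -(mulmxA _ w w) WW // -(mulmxA L (P h)) PPl ?leq_subr //
    -(mulmxA L) PPl.
have V3U3 : V3 *m U3 = Q.
  by rewrite defU3 defV3 -wPw -!mulmxA; congr (_ *m _); rewrite !mulmxA eP.
have U3Q : U3 *m Q = U3.
  have hw : P h *m w *m P rb = 0 by apply: PWP; rewrite /h; lia.
  by rewrite {1}defQ mulmxBr defU3 -!mulmxA WP -/w mulmxA (mulmxA (P h)) hw mulmx0 subr0.
have QV3 : Q *m V3 = V3.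
  have hw : P rb *m w *m P h = 0 by apply: PWP; rewrite /h; lia.
  by rewrite {1}defQ mulmxBl defV3 !mulmxA PW -/w hw mul0mx subr0.
have bQ : P rb *m Q = 0 by rewrite defQ mulmxBr !PPl // subrr.
have Qb : Q *m P rb = 0 by rewrite defQ mulmxBl PPr // PPl // subrr.
have XU3 : X *m U3 = 0 by rewrite -U3Q -V3U3 !mulmxA -(mulmxA X) U3V3 XE mul0mx.
have U'U3 : U' *m U3 = 0 by rewrite -U3Q -V3U3 !mulmxA -(mulmxA U') U3V3 U'E mul0mx.
have V3U : V3 *m U = 0 by rewrite -QV3 -V3U3 -!mulmxA (mulmxA U3) U3V3 EU mulmx0.
have V3Y : V3 *m Y = 0 by rewrite -QV3 -V3U3 -!mulmxA (mulmxA U3) U3V3 EY mulmx0.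
have UV3 : U *m V3 = 0 by rewrite -Ub -QV3 !mulmxA -(mulmxA U) bQ mulmx0 mul0mx.
have U3U' : U3 *m U' = 0 by rewrite -bU' -U3Q !mulmxA -(mulmxA U3) Qb mulmx0 mul0mx.
have aWb : P ra *m W d *m P rb = 0 by apply: PWP.
have bWa : P rb *m W d *m P ra = 0 by apply: PWP; lia.
have QWa : Q *m W d *m P ra = 0.
  by rewrite defQ !mulmxBl bWa subr0; apply: PWP; lia.
have aWQ : P ra *m W d *m Q = 0.
  by rewrite defQ !mulmxBr aWb subr0; apply: PWP; lia.
have dd : P d *m P d = P d by rewrite PPl.
have Qd : Q *m P d = Q by rewrite defQ mulmxBl !PPl //; lia.
have dQ : P d *m Q = Q by rewrite defQ mulmxBr !PPr //; lia.
exists (U + U3 + Y *m W d), (U' + V3 + W d *m X).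
have gb : (U + U3 + Y *m W d) *m P rb = U.
  rewrite !mulmxDl Ub -U3Q -mulmxA Qb mulmx0 addr0 -Ya -!mulmxA (mulmxA (P ra)) aWb.
  by rewrite mulmx0 addr0.
have Eee : P d *m E = E.
  by rewrite defE !mulmxBr dd !mulmxA dU dY.
have dU3 : P d *m U3 = U3 by rewrite -U3Q -V3U3 !mulmxA -(mulmxA (P d)) U3V3 Eee -U3V3.
have V3d : V3 *m P d = V3 by rewrite -QV3 -V3U3 -!mulmxA (mulmxA U3) U3V3 Ed -U3V3.
have Wdd : W d *m P d = W d by rewrite WP.
have dWd : P d *m W d = W d by rewrite PW.
have U3d : U3 *m P d = U3 by rewrite -U3Q -mulmxA Qd.
have dV3 : P d *m V3 = V3 by rewrite -QV3 mulmxA dQ.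
have Ubd : U *m P d = U by rewrite -Ub -mulmxA PPl //; lia.
have dU' : P d *m U' = U' by rewrite -bU' mulmxA PPr //; lia.
have UWX : U *m (W d *m X) = 0.
  by rewrite -Ub -aX -!mulmxA (mulmxA (P rb)) (mulmxA _ (P ra)) bWa mul0mx mulmx0.
have U3WX : U3 *m (W d *m X) = 0.
  by rewrite -U3Q -aX -!mulmxA (mulmxA Q) (mulmxA _ (P ra)) QWa mul0mx mulmx0.
have YWU : Y *m W d *m U' = 0.
  by rewrite -Ya -bU' -!mulmxA (mulmxA (P ra)) (mulmxA _ (P rb)) aWb mul0mx mulmx0.
have YWV : Y *m W d *m V3 = 0.
  by rewrite -Ya -QV3 -!mulmxA (mulmxA (P ra)) (mulmxA _ Q) aWQ mul0mx mulmx0.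
have YWX : Y *m W d *m (W d *m X) = Y *m X.
  by rewrite -mulmxA (mulmxA (W d)) WW // -{1}aX (mulmxA (P d)) PPr ?aX //; lia.
split=> //; [split| |] => //.
- rewrite !mulmxDl !mulmxDr UV3 U3U' U3V3 UWX U3WX YWU YWV YWX !addr0 !add0r.
  by rewrite (addrC (U *m U')) addrAC defE !subrK.
- rewrite !mulmxDl !mulmxDr U'U U'U3 V3U V3U3 !mulmxA U'Y V3Y !mul0mx !addr0 add0r.
  rewrite -(mulmxA (W d)) XU -(mulmxA (W d)) XU3 !mulmx0 !add0r -(mulmxA (W d)) XY WPW //;
    last by lia.
  by rewrite defQ (addrC (P rb)) subrK addrC subrK.
- by rewrite !mulmxDr dU dU3 mulmxA dY.
- by rewrite !mulmxDl Ubd U3d -mulmxA Wdd.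
- by rewrite !mulmxDr !mulmxDl dU' dV3 mulmxA dWd U'd V3d -!mulmxA Xd.
- by rewrite !mulmxDr XU XU3 !add0r mulmxA XY.
Qed.

End LeadFlip.

Local Notation P := (@lead_proj _ _).
Local Notation W := (@flip_mx _ _).

(** * Complexes in padded matrices and their normal form *)

Section Complexes.
Variables (K : fieldType) (A : finType) (n : nat) (s t : A -> nat).
Variables (prev next : A -> option A).
Hypotheses (sn : forall a, (s a <= n)%N) (tn : forall a, (t a <= n)%N).
Hypothesis prev_next : forall a b, prev a = Some b <-> next b = Some a.
Hypothesis glue : forall a b, prev a = Some b -> s a = t b.
Implicit Types (F T : A -> 'M[K]_n) (r : A -> nat).

Definition supported F := forall a, P (t a) *m F a = F a /\ F a *m P (s a) = F a.
(** [prev a = Some b] encodes the relation [a b = 0]. *)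
Definition is_complex F := forall a b, prev a = Some b -> F a *m W (s a) *m F b = 0.
Definition at_opt r (o : option A) : nat := if o is Some b then r b else 0.
Definition admissible_ranks r :=
  forall a, (r a <= t a)%N /\ (r a + at_opt r (prev a) <= s a)%N.

Definition inv_pair d (g g' : 'M[K]_n) :=
  [/\ g *m g' = P d, g' *m g = P d, P d *m g = g, g *m P d = g
    & P d *m g' = g' /\ g' *m P d = g'].

Lemma inv_pair_sym d g g' : inv_pair d g g' -> inv_pair d g' g.
Proof. by case=> ? ? ? ? [? ?]; split. Qed.

(** Base changes at the targets and sources of the arrows. The last condition says
    that source and target base change agree at a place where two arrows with zero
    product meet, which is what makes the action preserve complexes. *)
Definition frame (gt gt' gs gs' : A -> 'M[K]_n) :=
  (forall a, inv_pair (t a) (gt a) (gt' a) /\ inv_pair (s a) (gs a) (gs' a)) /\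
  (forall a b, prev a = Some b -> gs a *m W (s a) *m gt b = W (s a)).

Lemma frame_sym gt gt' gs gs' : frame gt gt' gs gs' -> frame gt' gt gs' gs.
Proof.
move=> [H1 H2]; split=> [a|a b e].
  by have [h1 h2] := H1 a; split; apply: inv_pair_sym.
have [[_ _ _ _ _] [_ h2 _ _ [h5 h6]]] := H1 a.
have [[k1 _ k3 _ [k5 _]] _] := H1 b.
rewrite -{1}(H2 _ _ e) !mulmxA h2 -!mulmxA k1 (glue e) WP PW //.
Qed.

Lemma mulmxV_frame gt gt' gs gs' F : frame gt gt' gs gs' -> supported F ->
  forall a, gt' a *m (gt a *m F a *m gs a) *m gs' a = F a.
Proof.
move=> [H _] sF a; have [[_ h _ _ _] [k _ _ _ _]] := H a.
have [e1 e2] := sF a.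
by rewrite -!mulmxA k e2 mulmxA h e1.
Qed.

Lemma frame_supported gt gt' gs gs' F : frame gt gt' gs gs' ->
  supported (fun a => gt a *m F a *m gs a).
Proof.
move=> [H _] a; have [[_ _ h _ _] [_ _ _ k _]] := H a.
by rewrite -!mulmxA k !mulmxA h.
Qed.

Lemma frame_complex gt gt' gs gs' F : frame gt gt' gs gs' -> supported F ->
  is_complex F -> is_complex (fun a => gt a *m F a *m gs a).
Proof.
move=> [H1 H2] sF cF a b e.
have -> : gt a *m F a *m gs a *m W (s a) *m (gt b *m F b *m gs b) =
    gt a *m (F a *m (gs a *m W (s a) *m gt b) *m F b) *m gs b by rewrite !mulmxA.
by rewrite H2 // cF // mulmx0 mul0mx.
Qed.

(** The image of [F b] lies in the kernel of [F a]. *)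
Lemma complex_ranks F : supported F -> is_complex F ->
  admissible_ranks (fun a => \rank (F a)).
Proof.
move=> sF cF a; have [e1 e2] := sF a; split.
  by rewrite -e1; apply: leq_trans (mxrankM_maxl _ _) (rankP_le _ _ _).
case e: (prev a) => [b|] /=; last first.
  by rewrite addn0 -e2; apply: leq_trans (mxrankM_maxr _ _) (rankP_le _ _ _).
have -> : \rank (F a) = \rank (F a *m W (s a)).
  apply/eqP; rewrite eqn_leq mxrankM_maxl andbT.
  by rewrite -{1}e2 -WW // mulmxA mxrankM_maxl.
apply: rank_mul0_le (sn a) _ _ _; last exact: cF.
  by rewrite -mulmxA WP.
by rewrite (glue e); case: (sF b).
Qed.

(** Factor every [F a] through its image and choose an adapted basis at every place
    where two arrows with zero product meet or a thread ends. The factorization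
    is fixed for each arrow beforehand, so the choices at its two ends are
    independent and cyclic threads need no special treatment. *)
Lemma normal_form F : supported F -> is_complex F ->
  exists gt gt' gs gs', frame gt gt' gs gs' /\
    forall a, F a = gt a *m P (\rank (F a)) *m gs a.
Proof.
move=> sF cF; have adm := complex_ranks sF cF; pose r a := \rank (F a).
have /fin_all_exists[U /fin_all_exists[U' /fin_all_exists[V /fin_all_exists[V' H]]]] a :=
  rank_factor (sF a).1 (sF a).2.
have E1 a : exists g g', [/\ inv_pair (s a) g g', 
    forall b, prev a = Some b -> g *m P (r b) = U b & V a *m W (s a) *m g = P (r a) *m W (s a)].
  have [eF [u1 u2 u3 u4 u5] [v1 v2 v3 v4 v5]] := H a.
  have [hr hs] := adm a.
  have XX : [/\ V a *m W (s a) *m P (s a) = V a *m W (s a), P (r a) *m (V a *m W (s a)) = V a *m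
    W (s a),
      V a *m W (s a) *m (W (s a) *m V' a) = P (r a), P (s a) *m (W (s a) *m V' a) = W (s a) *m V'
        a
      & W (s a) *m V' a *m P (r a) = W (s a) *m V' a].
    split; first by rewrite -mulmxA WP.
    - by rewrite mulmxA v2.
    - by rewrite mulmxA -(mulmxA (V a)) WW // v1 v3.
    - by rewrite mulmxA PW.
    - by rewrite -mulmxA v5.
  case e: (prev a) hs => [b|] /= hs.
    have [eFb [w1 w2 w3 w4 w5] [z1 z2 z3 z4 z5]] := H b.
    have XU : V a *m W (s a) *m U b = 0.
      have := cF _ _ e; rewrite eF eFb => /(congr1 (fun M => U' a *m M *m V' b)).
      rewrite mulmx0 mul0mx !mulmxA u3 v2 -!mulmxA z3.
      by rewrite [U b *m _]w2.
    rewrite -(glue e) in w1 w4.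
    have UU := And5 w1 w2 w3 w4 w5.
    have [g [g' [[h1 h2 h3 h4] [h5 h6] h7 h8]]] := adapted_basis (sn a) hs UU XX XU.
    by exists g, g'; split; [split|move=> _ [<-]|].
  pose O : 'M[K]_n := 0.
  have UU : [/\ P (s a) *m O = O, O *m P 0 = O, O *m O = P 0, O *m P (s a) = O & P 0 *m O = O].
    by rewrite P0; split; rewrite ?mulmx0 ?mul0mx.
  have [g [g' [[h1 h2 h3 h4] [h5 h6] h7 h8]]] := adapted_basis (sn a) hs UU XX (mulmx0 _ _).
  by exists g, g'; split; [split| |].
have /fin_all_exists[g /fin_all_exists[g' Hg]] := E1.
have E2 b : exists k k', [/\ inv_pair (t b) k k', k *m P (r b) = U b & 
    forall a, prev a = Some b -> k = g a].
  case e: (next b) => [a|].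
    have e' : prev a = Some b by apply/prev_next.
    have [h1 h2 h3] := Hg a; exists (g a), (g' a); split=> //.
    - by rewrite -(glue e').
    - exact: h2.
    - by move=> a' /prev_next; rewrite e => -[->].
  have [_ uu _] := H b.
  have le : (0 + r b <= t b)%N by case: (adm b).
  pose O : 'M[K]_n := 0.
  have XX : [/\ O *m P (t b) = O, P 0 *m O = O, O *m O = P 0, P (t b) *m O = O & O *m P 0 = O].
    by rewrite P0; split; rewrite ?mulmx0 ?mul0mx.
  have [k [k' [[h1 h2 h3 h4] [h5 h6] h7 h8]]] := adapted_basis (tn b) le uu XX (mul0mx _ _).
  by exists k, k'; split; [split| |move=> a /prev_next; rewrite e].
have /fin_all_exists[k /fin_all_exists[k' Hk]] := E2.
exists k, k', (fun a => W (s a) *m g' a *m W (s a)), (fun a => W (s a) *m g a *m W (s a)).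
have Hs a : inv_pair (s a) (W (s a) *m g' a *m W (s a)) (W (s a) *m g a *m W (s a)).
  have [[h1 h2 h3 h4 [h5 h6]] _ _] := Hg a.
  split.
  - by rewrite !mulmxA -(mulmxA (W (s a) *m g' a) (W _)) WW // -(mulmxA (W _) (g' a)) h6 -(mulmxA
      (W _) (g' a)) h2 WP WW.
  - by rewrite !mulmxA -(mulmxA (W (s a) *m g a) (W _)) WW // -(mulmxA (W _) (g a)) h4 -(mulmxA
      (W _) (g a)) h1 WP WW.
  - by rewrite !mulmxA PW.
  - by rewrite -!mulmxA WP.
  - by rewrite !mulmxA PW -!mulmxA WP.
split.
  split=> [a|a b e]; first by split=> //; case: (Hk a).
  have [_ _ /(_ _ e) ->] := Hk b; have [[h1 h2 h3 h4 [h5 h6]] _ _] := Hg a.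
  by rewrite -(mulmxA _ (W _) (W _)) WW // -(mulmxA _ (P _)) h3 -mulmxA h2 WP.
move=> a; have [h1 h2 h3] := Hk a; have [[k1 k2 k3 k4 [k5 k6]] _ k7] := Hg a.
have [eF [_ u2 _ _ _] [v1 v2 v3 v4 v5]] := H a.
have eV : V a = P (r a) *m (W (s a) *m g' a *m W (s a)).
  rewrite !mulmxA -k7 -(mulmxA _ (g a)) k1 -(mulmxA (V a)) WP.
  by rewrite -mulmxA WW.
by rewrite -/(r a) h2 {1}eF eV mulmxA [U a *m P _]u2.
Qed.

End Complexes.

(** * Polynomial charts of the rank strata *)

Lemma mxDE (V : nmodType) p q (A B : 'M[V]_(p, q)) i j : (A + B) i j = A i j + B i j.
Proof. by rewrite mxE. Qed.

Lemma mxBE (V : zmodType) p q (A B : 'M[V]_(p, q)) i j : (A - B) i j = A i j - B i j.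
Proof. by rewrite !mxE. Qed.

Section Spread.
Variables (K : fieldType) (A : finType) (n : nat) (X : {set A * 'I_n * 'I_n}).

(** Coordinates on the families of matrices with entries supported in [X]. *)
Definition spread (p : 'rV[K]_#|X|) (a : A) : 'M[K]_n :=
  \matrix_(i, j) \sum_k (enum_val k == (a, i, j))%:R * p 0 k.

Definition gather (F : A -> 'M[K]_n) : 'rV[K]_#|X| :=
  \row_k F (enum_val k).1.1 (enum_val k).1.2 (enum_val k).2.

Lemma spread_val p k :
  spread p (enum_val k).1.1 (enum_val k).1.2 (enum_val k).2 = p 0 k.
Proof.
rewrite mxE (bigD1 k) //= big1 ?addr0 => [|l ne].
  by case: (enum_val k) => -[a i] j; rewrite eqxx mul1r.
case: eqP => [e|_]; last by rewrite mul0r.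
case/eqP: ne; apply: enum_val_inj; rewrite e.
by case: (enum_val k) => -[].
Qed.

Lemma spread_out p a i j : (a, i, j) \notin X -> spread p a i j = 0.
Proof.
move=> nX; rewrite mxE big1 // => k _; case: eqP => [e|_]; last by rewrite mul0r.
by rewrite -e enum_valP in nX.
Qed.

Lemma gatherK F a i j : (a, i, j) \in X -> spread (gather F) a i j = F a i j.
Proof.
move=> aX; have [k e] : exists k : 'I_#|X|, enum_val k = (a, i, j).
  by exists (enum_rank_in aX (a, i, j)); rewrite enum_rankK_in.
by have := spread_val (gather F) k; rewrite e /= => ->; rewrite mxE e.
Qed.

Lemma polymx_spread a : polymx (fun p => spread p a).
Proof.
move=> i j.
have H k : polyf (fun p : 'rV[K]_#|X| => (enum_val k == (a, i, j))%:R * p 0 k).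
  by apply: polyf_mul; [apply: polyf_const|apply: polyf_coord].
by apply: (polyf_ext _ (polyf_sum (index_enum _) predT H)) => p; rewrite mxE.
Qed.

End Spread.

(** The entries in the first [r] columns, together with the entries in the first
    [u] rows and in the columns left over by the image of the previous arrow. For
    [u = r] these are the parameters of a rank stratum; for another [u] they are the
    free entries of a tangent vector. *)
Definition ell_set (A : finType) n (s t : A -> nat) (prev : A -> option A)
    (r u : A -> nat) : {set A * 'I_n * 'I_n} :=
  [set x : A * 'I_n * 'I_n | ((x.1.2 < t x.1.1) && (x.2 < r x.1.1))%N
        || ((x.1.2 < u x.1.1) && (x.2 < s x.1.1 - at_opt r (prev x.1.1)))%N].

Section Param.
Variables (K : fieldType) (A : finType) (n : nat) (s t : A -> nat).
Variables (prev : A -> option A).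
Hypotheses (sn : forall a, (s a <= n)%N) (tn : forall a, (t a <= n)%N).
Hypothesis glue : forall a b, prev a = Some b -> s a = t b.
Variable r : A -> nat.
Hypothesis adm : admissible_ranks s t prev r.
Implicit Types (F T : A -> 'M[K]_n).

Local Notation rp a := (at_opt r (prev a)).

Let rt a : (r a <= t a)%N. Proof. by case: (adm a). Qed.
Let rs a : (r a + rp a <= s a)%N. Proof. by case: (adm a). Qed.

(** The factors of a family of rank at most [r]: [core] is the middle factor [C] of
    size [r], the left factor [U = lfac] has the identity as its first [r] rows, and
    the right factor [V = rfac] has it as its first [r] columns. The columns of [V] on
    the image of the previous arrow [b] are determined by the remaining entries of [U]
    and [V], collected in [lfac] and [rfac0], through [V_a U_b = 0]; since [U_b] starts
    with an identity block, solving this equation requires no division. *)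
Definition core T a := P (r a) *m T a *m P (r a).
Definition lfac T a := P (r a) + (P (t a) - P (r a)) *m T a *m P (r a).
Definition rfac0 T a :=
  P (r a) + P (r a) *m T a *m (P (s a - rp a) - P (r a)).
Definition rfac T a :=
  rfac0 T a -
  (if prev a is Some b then rfac0 T a *m W (s a) *m lfac T b *m W (s a) else 0).
Definition param T a := lfac T a *m core T a *m rfac T a.

Let rq a : (r a <= s a - rp a)%N. Proof. by have := rs a; lia. Qed.
#[local] Hint Resolve rt rq : core.
Let PPrr a : P (r a) *m P (r a) = P (r a) :> 'M[K]_n. Proof. by rewrite PPl. Qed.

Lemma P_lfac T a : P (r a) *m lfac T a = P (r a).
Proof.
rewrite mulmxDr PPrr !mulmxA mulmxBr PPl // PPrr subrr.
by rewrite !mul0mx addr0.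
Qed.

Lemma lfac_P T a : lfac T a *m P (r a) = lfac T a.
Proof. by rewrite /lfac mulmxDl -!mulmxA PPrr. Qed.

Lemma Pt_lfac T a : P (t a) *m lfac T a = lfac T a.
Proof. by rewrite /lfac mulmxDr PPr // !mulmxA mulmxBr PPl // PPr. Qed.

Lemma rfac0_P T a : rfac0 T a *m P (r a) = P (r a).
Proof.
by rewrite mulmxDl PPrr -!mulmxA mulmxBl PPr // PPrr subrr !mulmx0 addr0.
Qed.

Lemma P_rfac0 T a : P (r a) *m rfac0 T a = rfac0 T a.
Proof. by rewrite /rfac0 mulmxDr PPrr !mulmxA PPrr. Qed.

Lemma rfac0_Pq T a : rfac0 T a *m P (s a - rp a) = rfac0 T a.
Proof. by rewrite /rfac0 mulmxDl PPl // -!mulmxA mulmxBl PPl // PPl. Qed.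

Let qs a : (s a - rp a <= s a)%N. Proof. exact: leq_subr. Qed.
#[local] Hint Resolve qs : core.

Lemma rfac_Ps T a : rfac T a *m P (s a) = rfac T a.
Proof.
have V0s : rfac0 T a *m P (s a) = rfac0 T a by rewrite -rfac0_Pq -mulmxA PPl.
rewrite /rfac mulmxBl V0s.
case: (prev a) => [b|]; last by rewrite mul0mx.
by rewrite -!mulmxA WP.
Qed.

Lemma P_flip_Pq a b : prev a = Some b -> P (r b) *m W (s a) *m P (s a - rp a) = 0 :> 'M[K]_n.
Proof. by move=> e; apply: PWP; rewrite e /= subnKC //; have := rs a; rewrite e /=; lia. Qed.

Lemma rfac_Pq T a : rfac T a *m P (s a - rp a) = rfac0 T a.
Proof.
rewrite /rfac mulmxBl rfac0_Pq; set q := (s a - rp a)%N.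
have E b : prev a = Some b ->
    rfac0 T a *m W (s a) *m lfac T b *m W (s a) *m P q = 0.
  by move=> /P_flip_Pq e; rewrite -lfac_P -!mulmxA (mulmxA (P (r b))) e !mulmx0.
by case: (prev a) E => [b /(_ b erefl) ->|_]; rewrite ?mul0mx subr0.
Qed.

Lemma rfac_P T a : rfac T a *m P (r a) = P (r a).
Proof. by rewrite -(PPr _ _ (rq a)) mulmxA rfac_Pq rfac0_P PPr. Qed.

(** The last columns of [V] are defined so as to make this vanish. *)
Lemma rfac_flip_lfac T a b : prev a = Some b -> rfac T a *m W (s a) *m lfac T b = 0.
Proof.
move=> e; rewrite /rfac e !mulmxBl.
have UU : lfac T b *m lfac T b = lfac T b by rewrite -{1}lfac_P -mulmxA P_lfac lfac_P.
rewrite -(mulmxA _ (W (s a)) (W (s a))) WW // -(mulmxA _ (P _)) (glue e) Pt_lfac.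
by rewrite -(mulmxA _ (lfac T b)) UU subrr.
Qed.

Lemma param_supported T : supported s t (param T).
Proof. by move=> a; rewrite /param -!mulmxA rfac_Ps mulmxA Pt_lfac. Qed.

Lemma param_complex T : is_complex s prev (param T).
Proof.
move=> a b e; rewrite /param.
have -> : lfac T a *m core T a *m rfac T a *m W (s a) *m
   (lfac T b *m core T b *m rfac T b) = lfac T a *m core T a *m
   (rfac T a *m W (s a) *m lfac T b) *m (core T b *m rfac T b).
  by rewrite !mulmxA.
by rewrite rfac_flip_lfac // mulmx0 mul0mx.
Qed.

Lemma core_P T a : core T a *m P (r a) = core T a.
Proof. by rewrite /core -mulmxA PPrr. Qed.

Lemma P_core T a : P (r a) *m core T a = core T a.
Proof. by rewrite /core !mulmxA PPrr. Qed.

Lemma param_P T a : param T a *m P (r a) = lfac T a *m core T a.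
Proof. by rewrite /param -mulmxA rfac_P -mulmxA core_P. Qed.

Lemma P_param T a : P (r a) *m param T a = core T a *m rfac T a.
Proof. by rewrite /param mulmxA (mulmxA (P _) (lfac T a)) P_lfac P_core. Qed.

Lemma P_param_P T a : P (r a) *m param T a *m P (r a) = core T a.
Proof. by rewrite P_param -mulmxA rfac_P core_P. Qed.

Definition param_set := ell_set n s t prev r r.

Lemma param_entryC T a (i j : 'I_n) : (i < r a)%N -> (j < r a)%N ->
  param T a i j = T a i j.
Proof.
move=> hi hj; have := congr1 (fun M : 'M[K]_n => M i j) (P_param_P T a).
by rewrite /core !mulPr !mulPl hi hj.
Qed.

(** When the middle factor is the identity, the entries of [param T] in the
    parameter positions are the parameters. Chains therefore free the entries of the
    outer factors first, with the middle factor fixed. *)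
Lemma param_entry T a i j : core T a = P (r a) -> (a, i, j) \in param_set ->
  param T a i j = T a i j.
Proof.
move=> hC; rewrite inE /=; case: (ltnP j (r a)) => hj; case: (ltnP i (r a)) => hi.
- by move=> _; apply: param_entryC.
- rewrite andbT andFb orbF => hi'.
  have := congr1 (fun M : 'M[K]_n => M i j) (param_P T a); rewrite hC lfac_P.
  rewrite mulPr hj => ->; rewrite mxDE mulPr hj mulmxBl mxBE !mulPl hi' PE.
  by rewrite [(i < r a)%N]ltnNge hi andbF subr0 add0r.
- rewrite andbF /= => hj'.
  have := congr1 (fun M : 'M[K]_n => M i j) (congr1 (mulmx^~ (P (s a - rp a)%N)) (P_param T a)).
  rewrite -(mulmxA (core T a)) rfac_Pq hC P_rfac0 mulPr mulPl hi hj' => ->.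
  rewrite mxDE mulmxBr mxBE !mulPr hj' [(j < r a)%N]ltnNge hj mulPl hi subr0 PE.
  case: eqP => [e|_]; last by rewrite add0r.
  by move: hj; rewrite -e leqNgt hi.
- by rewrite andbF.
Qed.

Lemma param_ext T T' :
  (forall a i j, (a, i, j) \in param_set -> T a i j = T' a i j) ->
  forall a, param T a = param T' a.
Proof.
move=> H.
have eC a : core T a = core T' a.
  apply/matrixP=> i j; rewrite /core !mulPr !mulPl; case: ltnP => // hj; case: ltnP => // hi.
  by apply: H; rewrite inE /= hj (leq_trans hi (rt a)).
have eU a : lfac T a = lfac T' a.
  congr (_ + _); apply/matrixP=> i j; rewrite !mulPr; case: ltnP => // hj.
  rewrite !mulmxBl !mxBE !mulPl; case: ltnP => ht; last by case: ltnP => // hr; have :=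
    leq_trans hr (rt a); rewrite ltnNge ht.
  by rewrite H // inE /= hj ht.
have eV0 a : rfac0 T a = rfac0 T' a.
  congr (_ + _); apply/matrixP=> i j; rewrite -!mulmxA !mulPl; case: ltnP => // hi.
  rewrite !mulmxBr !mxBE !mulPr; case: ltnP => ht; last by case: ltnP => // hr; have :=
    leq_trans hr (rq a); rewrite ltnNge ht.
  by rewrite H // inE /= hi ht orbT.
have eV a : rfac T a = rfac T' a.
  by rewrite /rfac eV0; case: (prev a) => // b; rewrite eU.
by move=> a; rewrite /param eC eU eV.
Qed.

Lemma param_proj (r' : A -> nat) : (forall a, r' a <= r a)%N ->
  forall a, param (fun a => P (r' a)) a = P (r' a).
Proof.
move=> le.
have eC a : core (fun a => P (r' a)) a = P (r' a) by rewrite /core PPr // PPl.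
have eU a : lfac (fun a => P (r' a)) a = P (r a).
  rewrite /lfac mulmxBl PPr ?(leq_trans (le a)) // PPr // subrr.
  by rewrite mul0mx addr0.
have eV0 a : rfac0 (fun a => P (r' a)) a = P (r a).
  rewrite /rfac0 PPr // mulmxBr PPl ?(leq_trans (le a)) // PPl // subrr.
  by rewrite addr0.
have eV a : rfac (fun a => P (r' a)) a = P (r a).
  rewrite /rfac eV0; case e: (prev a) => [b|]; last by rewrite subr0.
  rewrite eU PWP ?mul0mx ?subr0 //.
  by have := rs a; rewrite e.
by move=> a; rewrite /param eC eU eV PPr // PPl.
Qed.

(** The leading block of size [k], completed by an identity so that its
    invertibility is that of a square matrix of full size. *)
Definition pivot (M : 'M[K]_n) k := P k *m M *m P k + (1%:M - P k).

(** A matrix of rank at most [k] with invertible leading block of size [k] is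
    recovered from its first [k] rows and columns: its rows are combinations of the
    first [k] ones. *)
Lemma pivot_factor (M : 'M[K]_n) k : (k <= n)%N -> (\rank M <= k)%N ->
  pivot M k \in unitmx -> let Ci := invmx (pivot M k) in
  [/\ Ci *m P k = P k *m Ci, P k *m M *m P k *m Ci = P k,
      Ci *m P k *m M *m P k = P k & M = M *m Ci *m P k *m M].
Proof.
move=> kn rM uC Ci.
have kk : P k *m P k = P k :> 'M[K]_n by rewrite PPl.
have k0 : P k *m (1%:M - P k) = 0 :> 'M[K]_n by rewrite mulmxBr mulmx1 kk subrr.
have k0' : (1%:M - P k) *m P k = 0 :> 'M[K]_n by rewrite mulmxBl mul1mx kk subrr.
have ePk : P k *m pivot M k = P k *m M *m P k.
  by rewrite mulmxDr k0 addr0 !mulmxA kk.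
have ekP : pivot M k *m P k = P k *m M *m P k.
  by rewrite mulmxDl k0' addr0 -!mulmxA kk.
have com : Ci *m P k = P k *m Ci.
  by rewrite -[P k in LHS](mulmxK uC) ePk -ekP !mulmxA mulVmx // mul1mx.
have e1 : P k *m M *m P k *m Ci = P k by rewrite -ePk mulmxK.
have e2 : Ci *m P k *m M *m P k = P k by rewrite -!mulmxA (mulmxA (P k)) -ekP mulKmx.
split=> //.
have rPM : (k <= \rank (P k *m M))%N.
  apply: leq_trans (mxrankM_maxl _ (P k)).
  have := mxrank_add (P k *m M *m P k) (1%:M - P k); rewrite -/(pivot M k) mxrank_unit //.
  have -> : \rank (1%:M - P k : 'M[K]_n) = (n - k)%N by exact: rank_copid_mx.
  by lia.
have /submxP[Y eY] : (M <= P k *m M)%MS.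
  rewrite -(geq_leqif (mxrank_leqif_sup (submxMl (P k) M))).
  exact: leq_trans rM rPM.
have h : M *m Ci *m P k = Y *m P k.
  by rewrite {1}eY -(mulmxA _ Ci) com -(mulmxA Y) (mulmxA (P k *m M)) e1.
by rewrite h -mulmxA -eY.
Qed.

(** The chart contains every complex of the given ranks with invertible leading
    blocks: [U] and [V] are the first columns and rows divided by the block, and the
    relation [V_a U_b = 0] follows by cancelling injective and surjective factors. *)
Lemma param_surj F : supported s t F -> is_complex s prev F ->
  (forall a, \rank (F a) <= r a)%N -> (forall a, pivot (F a) (r a) \in unitmx) ->
  exists T, forall a, param T a = F a.
Proof.
move=> sF cF rF uF; pose Ci a := invmx (pivot (F a) (r a)).
have rn a : (r a <= n)%N by exact: leq_trans (rt a) (tn a).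
have H a : [/\ Ci a *m P (r a) = P (r a) *m Ci a, P (r a) *m F a *m P (r a) *m Ci a = P (r a),
    Ci a *m P (r a) *m F a *m P (r a) = P (r a) & F a = F a *m Ci a *m P (r a) *m F a].
  exact: pivot_factor (rn a) (rF a) (uF a).
pose Pc a : 'M[K]_n := 1%:M - P (r a).
have PPc a : P (r a) *m Pc a = 0 by rewrite mulmxBr mulmx1 PPrr subrr.
have PcP a : Pc a *m P (r a) = 0 by rewrite mulmxBl mul1mx PPrr subrr.
(* first block, columns and rows of the chart parameters, in this order *)
pose T a := P (r a) *m F a *m P (r a) + Pc a *m (F a *m Ci a *m P (r a))
  + P (r a) *m Ci a *m F a *m Pc a.
have PT a : P (r a) *m T a = P (r a) *m F a *m P (r a) + P (r a) *m Ci a *m F a *m Pc a.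
  by rewrite !mulmxDr !mulmxA PPrr PPc !mul0mx addr0.
have TP a : T a *m P (r a) = P (r a) *m F a *m P (r a) + Pc a *m (F a *m Ci a *m P (r a)).
  by rewrite !mulmxDl -!mulmxA PPrr PcP !mulmx0 addr0.
have eC a : core T a = P (r a) *m F a *m P (r a).
  by rewrite /core PT mulmxDl -!mulmxA PPrr PcP !mulmx0 addr0.
have tPc a : (P (t a) - P (r a)) *m Pc a = P (t a) - P (r a).
  by rewrite mulmxBr mulmx1 mulmxBl PPr // PPrr subrr subr0.
have tP a : (P (t a) - P (r a)) *m P (r a) = 0 :> 'M[K]_n.
  by rewrite mulmxBl PPr // PPrr subrr.
have eU a : lfac T a = F a *m Ci a *m P (r a).
  have [com e1 e2 e3] := H a; have [tF _] := sF a.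
  rewrite /lfac -mulmxA TP mulmxDr !mulmxA tP !mul0mx add0r tPc.
  have PFCP : P (r a) *m F a *m Ci a *m P (r a) = P (r a).
    by rewrite -(mulmxA _ (Ci a)) com mulmxA e1.
  by rewrite -!mulmxA mulmxBl !mulmxA tF PFCP addrC subrK.
have qP a : P (r a) *m (P (s a - rp a)%N - P (r a)) = 0 :> 'M[K]_n.
  by rewrite mulmxBr PPl // PPrr subrr.
have qPc a : Pc a *m (P (s a - rp a)%N - P (r a)) = P (s a - rp a)%N - P (r a).
  by rewrite mulmxBl mul1mx qP subr0.
have eV0 a : rfac0 T a = P (r a) *m Ci a *m F a *m P (s a - rp a).
  have [com e1 e2 e3] := H a.
  rewrite /rfac0 PT mulmxDl -(mulmxA _ (P (r a))) qP mulmx0 add0r -mulmxA qPc mulmxBr.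
  by rewrite -com e2 addrC subrK.
have eV a : rfac T a = P (r a) *m Ci a *m F a.
  have [_ sF2] := sF a; rewrite /rfac eV0; set V := P (r a) *m Ci a *m F a.
  have Vs' : V *m P (s a) = V by rewrite -mulmxA sF2.
  case e: (prev a) => [b|] /=; last by rewrite subn0 subr0.
  have VU : V *m W (s a) *m lfac T b = 0.
    by rewrite eU !mulmxA -(mulmxA _ (F a)) -(mulmxA _ (F a *m W _)) (cF _ _ e) mulmx0 !mul0mx.
  clearbody V; have rbs : (r b <= s a)%N by have := rs a; rewrite e /=; lia.
  have key : V *m P (s a - r b) *m W (s a) *m lfac T b = - (V *m W (s a) *m P (r b)).
    apply/eqP; rewrite -subr_eq0 opprK; apply/eqP.
    have dec : V = V *m P (s a - r b) + V *m (W (s a) *m P (r b) *m W (s a)).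
      by rewrite WPW // mulmxBr Vs' addrC subrK.
    rewrite -[RHS]VU [in RHS]dec !mulmxDl; congr (_ + _).
    by rewrite -!mulmxA (mulmxA (W (s a)) (W (s a))) WW // (glue e) Pt_lfac P_lfac.
  rewrite key mulNmx opprK -!mulmxA (mulmxA (W _)) WPW // mulmxBr Vs'.
  by rewrite addrC subrK.
exists T => a; have [com e1 e2 e3] := H a.
rewrite /param eC eU eV [RHS]e3 -!mulmxA !(mulmxA (P (r a)) (P (r a))) !PPrr.
by congr (_ *m (_ *m _)); rewrite !mulmxA e1.
Qed.

End Param.

(** * Dimension count and tangent spaces at the normal form *)

Section ParamPoly.
Variables (K : fieldType) (A : finType) (n D : nat) (s t : A -> nat).
Variables (prev : A -> option A) (r : A -> nat).

Lemma polymx_param (T : 'rV[K]_D -> A -> 'M[K]_n) :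
  (forall a, polymx (fun v => T v a)) ->
  forall a, polymx (fun v => param s t prev r (T v) a).
Proof.
move=> hT.
have hU a : polymx (fun v => lfac t r (T v) a).
  by apply: polymx_add; [apply: polymx_const|apply: polymx_mul; [apply: polymx_mul;
    [apply: polymx_const|]|apply: polymx_const]].
have hC a : polymx (fun v => core r (T v) a).
  by apply: polymx_mul; [apply: polymx_mul; [apply: polymx_const|]|apply: polymx_const].
have hV0 a : polymx (fun v => rfac0 s prev r (T v) a).
  by apply: polymx_add; [apply: polymx_const|apply: polymx_mul; [apply: polymx_mul;
    [apply: polymx_const|]|apply: polymx_const]].
have hV a : polymx (fun v => rfac s t prev r (T v) a).
  apply: polymx_add => //; apply: polymx_opp; case: (prev a) => [b|]; last exact: polymx_const.
  by apply: polymx_mul; [apply: polymx_mul; [apply: polymx_mul;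
    [|apply: polymx_const]|]|apply: polymx_const].
by move=> a; apply: polymx_mul => //; apply: polymx_mul.
Qed.

End ParamPoly.

Section Counting.
Variables (A : finType) (n : nat) (s t : A -> nat).
Variables (prev next : A -> option A).
Hypotheses (sn : forall a, (s a <= n)%N) (tn : forall a, (t a <= n)%N).
Hypothesis prev_next : forall a b, prev a = Some b <-> next b = Some a.
Hypothesis glue : forall a b, prev a = Some b -> s a = t b.
Implicit Types (r u : A -> nat).

Lemma sum_ltn c : (c <= n)%N -> (\sum_(j < n) (j < c) = c)%N.
Proof.
move=> le; transitivity (\sum_(j < n | (j < c)%N) 1)%N.
  by rewrite [RHS]big_mkcond; apply: eq_bigr => j _; case: ltnP.
by rewrite (big_ord_narrow le) sum1_card card_ord.
Qed.

Lemma sum_between c e : (c <= e)%N -> (e <= n)%N -> (\sum_(j < n) (c <= j < e) = e - c)%N.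
Proof.
move=> le1 le2; apply/eqP; rewrite -(eqn_add2l c) subnKC //.
rewrite -{1}(sum_ltn (leq_trans le1 le2)) -big_split /=; apply/eqP.
rewrite -[RHS](sum_ltn le2); apply: eq_bigr => j _.
by case: ltnP => h /=; rewrite ?(leq_trans h le1).
Qed.

Lemma card_ell r u :
  (forall a, r a + at_opt r (prev a) <= s a)%N -> (forall a, u a <= t a)%N ->
  #|ell_set n s t prev r u| = (\sum_a (t a * r a + u a * (s a - at_opt r (prev a) - r a)))%N.
Proof.
move=> hs hu; rewrite -sum1_card big_mkcond /=.
transitivity (\sum_a \sum_i \sum_j if (a, i, j) \in ell_set n s t prev r u then 1 else 0)%N.
  by rewrite !pair_bigA; apply: eq_bigr => -[[a i] j].
apply: eq_bigr => a _; set q := (s a - _)%N.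
have rq : (r a <= q)%N by have := hs a; rewrite /q; lia.
have qn : (q <= n)%N by exact: leq_trans (leq_subr _ _) (sn a).
transitivity (\sum_(i < n) \sum_(j < n) ((i < t a) * (j < r a) + (i < u a) * (r a <= j < q)))%N.
  apply: eq_bigr => i _; apply: eq_bigr => j _; rewrite inE /= -/q.
  case: (ltnP j (r a)) => hj /=.
    rewrite andbT (leq_trans hj rq) andbT muln0 addn0 muln1.
    by have := hu a; case: ltnP => //; case: ltnP => // h1 h2 h3; lia.
  by rewrite andbF muln0 add0n /=; case: (i < u a)%N; case: (j < q)%N.
transitivity (\sum_(i < n) ((i < t a) * r a + (i < u a) * (q - r a)))%N.
  apply: eq_bigr => i _; rewrite big_split /= -!big_distrr /=.
  by rewrite sum_ltn ?(leq_trans rq) // sum_between.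
by rewrite big_split /= -!big_distrl /= !sum_ltn // (leq_trans (hu a)).
Qed.

(** Both sides sum [r a * u b] over the relations [a b = 0]. *)
Lemma sum_prev_next r u :
  (\sum_a r a * at_opt u (prev a) = \sum_a u a * at_opt r (next a))%N.
Proof.
have E (f : A -> option A) (v w : A -> nat) : (\sum_a v a * at_opt w (f a) =
    \sum_a \sum_b (f a == Some b) * (v a * w b))%N.
  apply: eq_bigr => a _; case: (f a) => [b|] /=; last by rewrite muln0 big1.
  rewrite (bigD1 b) //= eqxx mul1n big1 ?addn0 // => c /negPf.
  by rewrite eq_sym => h; case: eqP => // -[] e; rewrite e eqxx in h.
rewrite !E exchange_big /=; apply: eq_bigr => b _; apply: eq_bigr => a _.
by rewrite [(u b * _)%N]mulnC; congr (nat_of_bool _ * _)%N; apply/eqP/eqP => /prev_next.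
Qed.

(** The sum over [a] of [r(a) (d(s(a)) + d(t(a)) - r(a))] minus the sum of
    [r(a) r(b)] over the relations [a b = 0]. *)
Definition param_dim r := (\sum_a (t a * r a + r a * (s a - at_opt r (prev a) - r a)))%N.
Definition tangent_count r :=
  (\sum_a (t a * r a + (t a - at_opt r (next a)) * (s a - at_opt r (prev a) - r a)))%N.

Lemma admissible_next r : admissible_ranks s t prev r ->
  forall a, (r a + at_opt r (next a) <= t a)%N.
Proof.
move=> adm a; case e: (next a) => [b|] /=; last by rewrite addn0; case: (adm a).
have e' : prev b = Some a by apply/prev_next.
by rewrite -(glue e') addnC; have [_] := adm b; rewrite e'.
Qed.

(** The contribution of [a] to the codimension of the stratum [r'] in the tangent
    space at a point of ranks [r]. With [delta = r' - r] it is
    [(h_t(a) - delta(a)) (h_s(a) - delta(a)) + delta(a) delta(b)]. *)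
Definition excess r r' a := ((t a - at_opt r (next a) - r' a) * (s a - at_opt r (prev a) - r' a)
   + (r' a - r a) * (at_opt r' (prev a) - at_opt r (prev a)))%N.

(** Arrow by arrow the two sides differ by [delta(a) r(c)] and [r(a) delta(b)], for
    the neighbours [c] and [b] of [a] in its thread; these terms cancel after
    summation over the relations. *)
Lemma tangent_count_excess r r' : admissible_ranks s t prev r ->
  admissible_ranks s t prev r' -> (forall a, r a <= r' a)%N ->
  tangent_count r = (param_dim r' + \sum_a excess r r' a)%N.
Proof.
move=> adm adm' le.
have ole o : (at_opt r o <= at_opt r' o)%N by case: o => //=.
have E : (\sum_a (r' a - r a) * at_opt r (next a) = 
    \sum_a r a * (at_opt r' (prev a) - at_opt r (prev a)))%N.
  rewrite -(sum_prev_next r (fun a => r' a - r a)%N); apply: eq_bigr => a _.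
  by case: (prev a).
apply/eqP; rewrite -(eqn_add2r (\sum_a (r' a - r a) * at_opt r (next a))%N) {2}E.
rewrite /tangent_count /param_dim -!big_split /=; apply/eqP/eq_bigr => a _.
have := admissible_next adm a; have := admissible_next adm' a.
have [h1 h2] := adm a; have [h3 h4] := adm' a; have := le a; have := ole (prev a); have :=
  ole (next a).
rewrite /excess; move: h1 h2 h3 h4.
move: (at_opt r (next a)) (at_opt r' (next a)) (at_opt r (prev a)) (at_opt r' (prev a)) =>
  rn rn' rp rp'.
move: (r a) (r' a) (t a) (s a) => x x' y z h1 h2 h3 h4 h5 h6 h7 h8 h9.
have [dx ex] : exists d, x' = (x + d)%N by exists (x' - x)%N; lia.
have [dp ep] : exists d, rp' = (rp + d)%N by exists (rp' - rp)%N; lia.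
have [dn en] : exists d, rn' = (rn + d)%N by exists (rn' - rn)%N; lia.
have [es ees] : exists d, z = (x + dx + rp + dp + d)%N by exists (z - (x' + rp'))%N; lia.
have [et eet] : exists d, y = (x + dx + rn + dn + d)%N by exists (y - (x' + rn'))%N; lia.
subst.
have -> : (x + dx + rn + dn + et - rn = x + dx + dn + et)%N by lia.
have -> : (x + dx + rp + dp + es - rp - x = dx + dp + es)%N by lia.
have -> : (x + dx + rp + dp + es - (rp + dp) - (x + dx) = es)%N by lia.
have -> : (x + dx + dn + et - (x + dx) = dn + et)%N by lia.
have -> : (x + dx + rp + dp + es - rp - (x + dx) = dp + es)%N by lia.
have -> : (x + dx - x = dx)%N by lia.
have -> : (rp + dp - rp = dp)%N by lia.
lia.
Qed.

(** Some relation [a b = 0] with nonzero homology at all its three places. *)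
Definition obstructed r :=
  exists a b, [/\ prev a = Some b, (r a + at_opt r (next a) < t a)%N,
    (r b + at_opt r (prev b) < s b)%N & (r a + r b < s a)%N].

Lemma param_dim_le r r' : admissible_ranks s t prev r ->
  admissible_ranks s t prev r' -> (forall a, r a <= r' a)%N ->
  (param_dim r' <= tangent_count r)%N.
Proof. by move=> h1 h2 h3; rewrite (tangent_count_excess h1 h2 h3) leq_addr. Qed.

(** If the excess vanished, then [delta(a) = 0] or [delta(b) = 0] at an obstructed
    relation, and the product of two homology dimensions left over at that arrow
    would be positive. *)
Lemma param_dim_lt r r' : admissible_ranks s t prev r ->
  admissible_ranks s t prev r' -> (forall a, r a <= r' a)%N ->
  obstructed r -> (param_dim r' < tangent_count r)%N.
Proof.
move=> h1 h2 h3 [a [b [e ha hb hab]]].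
rewrite (tangent_count_excess h1 h2 h3) -[X in (X < _)%N]addn0 ltn_add2l lt0n.
rewrite sum_nat_eq0; apply/negP => /forallP H.
have e' : next b = Some a by apply/prev_next.
have := H a; have := H b; rewrite /excess e e' /= !addn_eq0 !muln_eq0.
have := h3 a; have := h3 b; rewrite -(glue e).
have := h1 a; have := h1 b; have := h2 a; have := h2 b; rewrite e /=; lia.
Qed.

(** The ranks of the generic deformation of a complex without obstruction. *)
Definition fill_ranks r a :=
  (r a + minn (t a - at_opt r (next a) - r a) (s a - at_opt r (prev a) - r a))%N.

(** Without obstruction at most one of two neighbouring arrows can be increased, so
    the increments respect the rank conditions and kill both terms of the excess. *)
Lemma fill_ranks_spec r : admissible_ranks s t prev r -> ~ obstructed r ->
  admissible_ranks s t prev (fill_ranks r) /\ param_dim (fill_ranks r) = tangent_count r.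
Proof.
move=> adm nob; have admn := admissible_next adm.
have key a b : prev a = Some b -> fill_ranks r a = r a \/ fill_ranks r b = r b.
  move=> e; have e' : next b = Some a by apply/prev_next.
  have := adm a; have := adm b; have := admn a; have := admn b.
  rewrite /fill_ranks e e' /= => a1 a2 [a3 a4] [a5 a6].
  have [h|/eqP h] := eqVneq (minn (t a - at_opt r (next a) - r a) (s a - r b - r a)) 0%N.
    by left; rewrite h addn0.
  have [h'|/eqP h'] := eqVneq (minn (t b - r a - r b) (s b - at_opt r (prev b) - r b)) 0%N.
    by right; rewrite h' addn0.
  by case: nob; exists a, b; split=> //; lia.
have adm' : admissible_ranks s t prev (fill_ranks r).
  move=> a; have [a1 a2] := adm a; have a3 := admn a; split; first by rewrite /fill_ranks; lia.
  case e: (prev a) a2 => [b|] /= a2; last by rewrite /fill_ranks e /=; lia.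
  have e' : next b = Some a by apply/prev_next.
  have := adm b; have := admn b; rewrite e' /= => b1 [b2 b3].
  have := glue e; case: (key a b e) => ->; rewrite /fill_ranks ?e ?e' /=; lia.
split=> //; rewrite (tangent_count_excess adm adm') => [|a]; last exact: leq_addr.
rewrite big1 ?addn0 // => a _; rewrite /excess.
have -> : ((fill_ranks r a - r a) * (at_opt (fill_ranks r) (prev a) - at_opt r (prev a)) = 0)%N.
  case e: (prev a) => [b|] /=; last by rewrite muln0.
  by case: (key a b e) => ->; rewrite subnn ?muln0.
by rewrite /fill_ranks; have := adm a; have := admn a; lia.
Qed.

End Counting.

Section Tangent.
Variables (K : fieldType) (A : finType) (n : nat) (s t : A -> nat).
Variables (prev next : A -> option A).
Hypotheses (sn : forall a, (s a <= n)%N) (tn : forall a, (t a <= n)%N).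
Hypothesis prev_next : forall a b, prev a = Some b <-> next b = Some a.
Hypothesis glue : forall a b, prev a = Some b -> s a = t b.
Implicit Types (N Y F : A -> 'M[K]_n).
Variable r : A -> nat.
Hypothesis adm : admissible_ranks s t prev r.

(** The linearization of the relations [F a F b = 0]. *)
Definition tangent_at F N := forall a b, prev a = Some b ->
  N a *m W (s a) *m F b + F a *m W (s a) *m N b = 0.

Definition free_set := ell_set n s t prev r (fun a => t a - at_opt r (next a))%N.

(** The tangent vector at the normal form with free entries [Y]. On the image of [b]
    and in the rows of the image of [a] its entries are forced to be the negatives of
    entries of [Y b]; the remaining entries that are not free vanish. *)
Definition tangent_lift Y a :=
  Y a - (if prev a is Some b then P (r a) *m W (s a) *m Y b *m P (r b) *m W (s a) else 0).

Let rt a : (r a <= t a)%N. Proof. by case: (adm a). Qed.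
Let rs a : (r a + at_opt r (prev a) <= s a)%N. Proof. by case: (adm a). Qed.
Let rq a : (r a <= s a - at_opt r (prev a))%N. Proof. by have := rs a; lia. Qed.

Definition on_free Y := forall a i j, (a, i, j) \notin free_set -> Y a i j = 0.

Lemma on_free_col Y a b : on_free Y -> prev a = Some b -> Y a *m W (s a) *m P (r b) = 0.
Proof.
move=> hY e.
have -> : Y a = Y a *m P (s a - r b).
  apply/matrixP=> i j; rewrite mulPr; case: ltnP => // h; apply: hY.
  have := rq a; rewrite !inE /= e /= [(j < s a - r b)%N]ltnNge h andbF orbF.
  by move=> h2; rewrite [(j < r a)%N]ltnNge (leq_trans h2 h) andbF.
rewrite -!mulmxA (mulmxA (P _)) PWP ?mulmx0 // subnK //.
by have := rs a; rewrite e /=; lia.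
Qed.

Lemma on_free_row Y a b : on_free Y -> prev a = Some b ->
  P (r a) *m W (s a) *m Y b *m P (r b) = P (r a) *m W (s a) *m Y b.
Proof.
move=> hY e; have e' : next b = Some a by apply/prev_next.
have ra : (r a <= s a)%N by have := rs a; lia.
(* W P W cuts out the last rows, where Y b has entries only in its first columns *)
have wPw : W (s a) *m P (r a) *m W (s a) *m Y b *m P (r b) = W (s a) *m P (r a) *m W (s a) *m Y b.
  rewrite WPW //; apply/matrixP=> i j; rewrite mulPr; case: ltnP => // h.
  rewrite mulmxBl mxBE !mulPl; case: ltnP => hi; case: ltnP => hi2; rewrite ?subrr ?subr0 //.
    apply/esym/hY; rewrite inE /= [(j < r b)%N]ltnNge h andbF /= e' /= -(glue e).
    by rewrite [(i < s a - r a)%N]ltnNge hi2.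
  by have := leq_trans hi2 (leq_subr (r a) (s a)); rewrite ltnNge hi.
have := congr1 (mulmx (W (s a))) wPw; rewrite !mulmxA WW //.
by rewrite PPr.
Qed.

Lemma on_free_supported Y : on_free Y -> supported s t Y.
Proof.
move=> hY a; split; apply/matrixP=> i j; rewrite ?mulPl ?mulPr; case: ltnP => // h; apply/esym/hY.
  rewrite inE /= [(i < t a)%N]ltnNge h /= [(i < _ - _)%N]ltnNge (leq_trans _ h) //.
  exact: leq_subr.
have h1 : (s a - at_opt r (prev a) <= j)%N by apply: leq_trans h; apply: leq_subr.
by rewrite inE /= ![(j < _)%N]ltnNge h1 (leq_trans (rq a) h1) !andbF.
Qed.

Lemma tangent_lift_supported Y : on_free Y -> supported s t (tangent_lift Y).
Proof.
move=> hY a; have [h1 h2] := on_free_supported hY a; rewrite /tangent_lift.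
split; rewrite ?mulmxBr ?mulmxBl ?h1 ?h2; case: (prev a) => [b|]; rewrite ?mulmx0 ?mul0mx //.
  by rewrite !mulmxA PPr.
by rewrite -!mulmxA WP.
Qed.

Lemma tangent_lift_tangent Y : on_free Y -> tangent_at (fun a => P (r a)) (tangent_lift Y).
Proof.
move=> hY a b e; have rab : (r a + r b <= s a)%N by have := rs a; rewrite e.
rewrite /tangent_lift e !mulmxBl on_free_col // sub0r mulmxBr.
have -> : P (r a) *m W (s a) *m (if prev b is Some c then
    P (r b) *m W (s b) *m Y c *m P (r c) *m W (s b) else 0) = 0.
  case: (prev b) => [c|]; last by rewrite mulmx0.
  by rewrite !mulmxA PWP // !mul0mx.
rewrite subr0 -(mulmxA _ (W (s a)) (W (s a))) WW // -(mulmxA _ (P (s a))) PPr; last by lia.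
by rewrite -(mulmxA _ (P (r b)) (P (r b))) PPl // on_free_row // addNr.
Qed.

Lemma tangent_lift_free Y a i j : on_free Y -> (a, i, j) \in free_set ->
  tangent_lift Y a i j = Y a i j.
Proof.
move=> hY; rewrite inE /= => h.
have hj : (j < s a - at_opt r (prev a))%N.
  by case/orP: h => /andP[_ h]; [exact: leq_trans h (rq a)|].
rewrite /tangent_lift mxBE; case e: (prev a) hj => [b|] /= hj; last by rewrite mxE subr0.
suff -> : (P (r a) *m W (s a) *m Y b *m P (r b) *m W (s a)) i j = 0 by rewrite subr0.
have := mulPr (s a - r b) (P (r a) *m W (s a) *m Y b *m P (r b) *m W (s a)) i j.
rewrite hj => <-; rewrite -!mulmxA (mulmxA (P (r b))) PWP; first by rewrite !mulmx0 mxE.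
by rewrite subnKC //; have := rs a; rewrite e /=; lia.
Qed.

(** The tangent equation for [a b = 0] at the normal form, split by rows and columns
    into its blocks, says that the entries of [N] that are not free are those
    produced by [tangent_lift]. *)
Lemma tangent_lift_onto N Y : supported s t N -> tangent_at (fun a => P (r a)) N ->
  (forall a i j, Y a i j = if (a, i, j) \in free_set then N a i j else 0) ->
  forall a, N a = tangent_lift Y a.
Proof.
move=> sN tN hY a.
have eY c : Y c = N c *m P (r c) + P (t c - at_opt r (next c)) *m N c *m (P (s c - at_opt r (prev
  c)) - P (r c)).
  have [h1 h2] := sN c; apply/matrixP=> i j; rewrite hY inE /=.
  rewrite mxDE mulPr mulmxBr mxBE !mulPr !mulPl.
  case: (ltnP j (r c)) => hj.
    rewrite (leq_trans hj (rq c)) subrr addr0 andbT; case: ltnP => hi //=.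
    have -> : (i < t c - at_opt r (next c))%N = false.
      by apply/negbTE; rewrite -leqNgt; apply: leq_trans (leq_subr _ _) hi.
    by rewrite /= -h1 mulPl ltnNge hi.
  by rewrite andbF subr0 add0r /=; case: ltnP => _ //=; case: ltnP.
have row : N a *m P (s a - at_opt r (prev a)) = Y a.
  rewrite eY; suff -> : P (t a - at_opt r (next a)) *m N a *m (P (s a - at_opt r (prev a)) - P (r
    a)) =
      N a *m (P (s a - at_opt r (prev a)) - P (r a)).
    by rewrite mulmxBr addrC subrK.
  case e: (next a) => [c|] /=; last by rewrite subn0 (sN a).1.
  have e' : prev c = Some a by apply/prev_next.
  have H : P (r c) *m W (s c) *m N a *m (P (s a - at_opt r (prev a)) - P (r a)) = 0.
    have /(congr1 (mulmx^~ (P (s a - at_opt r (prev a)) - P (r a)))) := tN _ _ e'.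
    rewrite mul0mx mulmxDl -(mulmxA _ (P (r a))).
    have -> : P (r a) *m (P (s a - at_opt r (prev a)) - P (r a)) = 0 :> 'M[K]_n.
      by rewrite mulmxBr PPl // PPl // subrr.
    by rewrite mulmx0 add0r.
  have := congr1 (mulmx (W (s c))) H; rewrite !mulmxA mulmx0 WPW //; last first.
    by have := rs c; lia.
  rewrite (glue e') !mulmxBl (sN a).1 => /eqP; rewrite subr_eq0 => /eqP e0.
  by rewrite -e0.
rewrite /tangent_lift -{1}row; case e: (prev a) => [b|] /=; last by rewrite subn0 subr0 (sN a).2.
have eYb : Y b *m P (r b) = N b *m P (r b).
  rewrite eY mulmxDl -(mulmxA (N b)) PPl // -(mulmxA _ (_ - _)).
  have -> : (P (s b - at_opt r (prev b)) - P (r b)) *m P (r b) = 0 :> 'M[K]_n.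
    by rewrite mulmxBl PPr // PPl // subrr.
  by rewrite mulmx0 addr0.
rewrite -(mulmxA _ (Y b)) eYb.
have /(congr1 (mulmx^~ (P (r b) *m W (s a)))) := tN _ _ e.
rewrite mul0mx mulmxDl !mulmxA -(mulmxA _ (P (r b)) (P (r b))) PPl // => /eqP.
rewrite addr_eq0 => /eqP h; rewrite -h -!mulmxA (mulmxA (W (s a))) WPW //.
  by rewrite mulmxBr (sN a).2 addrC subrK.
by have := rs a; rewrite e /=; lia.
Qed.

End Tangent.

(** * Evaluation of paths in padded matrices *)

Section Pad.
Variables (R : comNzRingType) (n : nat).

Definition pad p q (A : 'M[R]_(p, q)) : 'M[R]_n :=
  (pid_mx p : 'M_(n, p)) *m A *m (pid_mx q : 'M_(q, n)).

Lemma pid_pid p : (p <= n)%N -> (pid_mx p : 'M[R]_(p, n)) *m (pid_mx p : 'M_(n, p)) = 1%:M.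
Proof. by move=> h; rewrite pid_mx_id // pid_mx_1. Qed.

Lemma padK p q (A : 'M[R]_(p, q)) : (p <= n)%N -> (q <= n)%N ->
  (pid_mx p : 'M_(p, n)) *m pad A *m (pid_mx q : 'M_(n, q)) = A.
Proof.
by move=> hp hq; rewrite /pad !mulmxA pid_pid // mul1mx -mulmxA pid_pid // mulmx1.
Qed.

Lemma padM p q l (A : 'M[R]_(p, q)) (B : 'M[R]_(q, l)) : (q <= n)%N ->
  pad A *m pad B = pad (A *m B).
Proof.
move=> h; rewrite /pad !mulmxA -(mulmxA _ (pid_mx q : 'M_(q, n))) pid_pid //.
by rewrite mulmx1 -!mulmxA.
Qed.

Lemma pad1 p : pad (1%:M : 'M_p) = pid_mx p.
Proof. by rewrite /pad mulmx1 pid_mx_id. Qed.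

Lemma pad_pidl p q (A : 'M[R]_(p, q)) : (pid_mx p : 'M_n) *m pad A = pad A.
Proof.
rewrite /pad !mulmxA; congr (_ *m _ *m _); by rewrite mul_pid_mx minnn pid_mx_minv.
Qed.

Lemma pad_pidr p q (A : 'M[R]_(p, q)) : pad A *m (pid_mx q : 'M_n) = pad A.
Proof.
rewrite /pad -!mulmxA; congr (_ *m (_ *m _)); by rewrite mul_pid_mx minnn pid_mx_minh.
Qed.

Lemma pad_conform p q p' q' (A : 'M[R]_(p', q')) : p' = p -> q' = q ->
  pad (conform_mx (0 : 'M_(p, q)) A) = pad A.
Proof. by move=> e1 e2; subst; rewrite conform_mx_id. Qed.

Lemma padD p q (A B : 'M[R]_(p, q)) : pad (A + B) = pad A + pad B.
Proof. by rewrite /pad mulmxDr mulmxDl. Qed.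

Lemma padZ p q c (A : 'M[R]_(p, q)) : pad (c *: A) = c *: pad A.
Proof. by rewrite /pad -scalemxAr -scalemxAl. Qed.

Lemma pad0 p q : pad (0 : 'M[R]_(p, q)) = 0.
Proof. by rewrite /pad mulmx0 mul0mx. Qed.

End Pad.

Lemma map_pad (R S : comNzRingType) (f : {rmorphism R -> S}) n p q (A : 'M[R]_(p, q)) :
  map_mx f (pad n A) = pad n (map_mx f A).
Proof. by rewrite /pad !map_mxM !map_pid_mx. Qed.

Section IdealMx.
Variables (R : comNzRingType) (J : R -> Prop).
Hypothesis idJ : is_ideal J.

Lemma ideal_sum (T : Type) (l : seq T) (Q : pred T) (f : T -> R) :
  (forall i, Q i -> J (f i)) -> J (\sum_(i <- l | Q i) f i).
Proof. by case: idJ => J0 JD _ H; elim/big_rec: _ => // i x Qi; apply: JD; apply: H. Qed.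

Definition mx_in p q (A : 'M[R]_(p, q)) := forall i j, J (A i j).

Lemma mx_inM p q l m (X : 'M[R]_(p, q)) (A : 'M[R]_(q, l)) (Y : 'M[R]_(l, m)) :
  mx_in A -> mx_in (X *m A *m Y).
Proof.
case: idJ => J0 JD JM hA i j; rewrite mxE; apply: ideal_sum => k _.
rewrite mxE big_distrl /=; apply: ideal_sum => k' _; exact: JM.
Qed.

Lemma mx_in_sum (T : Type) (l : seq T) (Q : pred T) p q (f : T -> 'M[R]_(p, q)) :
  (forall i, Q i -> mx_in (f i)) -> mx_in (\sum_(i <- l | Q i) f i).
Proof.
by move=> H i j; rewrite summxE; apply: ideal_sum => k Qk; apply: H.
Qed.

End IdealMx.

Section PathEval.
Variables (K : fieldType) (Q : quiver) (d : vertex Q -> nat).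
Variables (R : comNzRingType) (c : {rmorphism K -> R}) (M : rep R d).
Variable n : nat.
Hypothesis dn : forall i, (d i <= n)%N.

Definition arrow_prod (s : seq (arrow Q)) (X : 'M[R]_n) :=
  foldr (fun a X => pad n (M a) *m X) X s.

Definition padded_path (p : qpath Q) : 'M[R]_n :=
  arrow_prod (parrows p) (pid_mx (d (psrc p))).

Lemma arrow_prodM s X Y : arrow_prod s (X *m Y) = arrow_prod s X *m Y.
Proof. by elim: s => //= a s ->; rewrite mulmxA. Qed.

Lemma pad_walk i s : is_walk i s -> pad n (walk_mx M i s) = arrow_prod s (pid_mx (d i)).
Proof.
elim: s => [_|a s IH /= /andP[/eqP e /IH <-]] /=; first exact: pad1.
by rewrite -padM // pad_conform // e.
Qed.

Lemma pad_path p : pad n (path_mx M p) = padded_path p.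
Proof. by apply: pad_walk; case: p. Qed.

Lemma padded_pcat p q (e : psrc p = ptgt q) :
  padded_path (pcat e) = padded_path p *m padded_path q.
Proof.
have h : pid_mx (d (psrc p)) *m padded_path q = padded_path q.
  by rewrite e -pad_path pad_pidl.
rewrite [padded_path p]/padded_path -arrow_prodM h.
by rewrite /padded_path /arrow_prod -foldr_cat.
Qed.

Definition lin_ext (g : qpath Q -> 'M[R]_n) (x : path_algebra K Q) : 'M[R]_n :=
  \sum_(p <- dom x) c (coeff p x) *: g p.

Lemma lin_ext_widen g x l : uniq l -> {subset dom x <= l} ->
  lin_ext g x = \sum_(p <- l) c (coeff p x) *: g p.
Proof.
move=> ul sub; rewrite [RHS](bigID (mem (dom x))) /= [X in _ = _ + X]big1 ?addr0; last first.
  by move=> p np; rewrite coeff_outdom // rmorph0 scale0r.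
rewrite -[RHS]big_filter; apply: perm_big; apply: uniq_perm.
- exact: uniq_dom.
- exact: filter_uniq.
- by move=> p; rewrite mem_filter; case h: (p \in dom x); rewrite //= (sub _ h).
Qed.

Lemma lin_extD g k x y : lin_ext g (k *: x + y) = c k *: lin_ext g x + lin_ext g y.
Proof.
pose l := undup (dom x ++ dom y ++ dom (k *: x + y)).
have sub z : {subset dom z <= dom x ++ dom y ++ dom (k *: x + y)} -> {subset dom z <= l}.
  by move=> h p /h; rewrite mem_undup.
have E z : {subset dom z <= dom x ++ dom y ++ dom (k *: x + y)} ->
    lin_ext g z = \sum_(p <- l) c (coeff p z) *: g p.
  by move=> /sub; apply: lin_ext_widen; apply: undup_uniq.
rewrite !E; first last.
- by move=> p h; rewrite !mem_cat h !orbT.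
- by move=> p h; rewrite !mem_cat h.
- by move=> p h; rewrite !mem_cat h !orbT.
rewrite scaler_sumr -big_split; apply: eq_bigr => p _ /=.
by rewrite coeffD coeffZ rmorphD rmorphM scalerDl scalerA.
Qed.

Lemma lin_ext0 g : lin_ext g 0 = 0.
Proof. by rewrite /lin_ext dom0 big_nil. Qed.

Lemma lin_ext_path g p : lin_ext g (of_path K p) = g p.
Proof. by rewrite /lin_ext /of_path domU1 big_seq1 coeffU eqxx mul1r rmorph1 scale1r. Qed.

Definition block i j (p : qpath Q) : 'M[R]_n :=
  if (psrc p == i) && (ptgt p == j) then padded_path p else 0.

Lemma pad_pa_mx x i j : pad n (pa_mx c M x i j) = lin_ext (block i j) x.
Proof.
rewrite /pa_mx /lin_ext [in LHS]big_mkcond /=.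
rewrite (big_morph (@pad R n _ _) (@padD R n _ _) (@pad0 R n _ _)).
apply: eq_bigr => p _; rewrite /block; case: ifP => [/andP[/eqP e1 /eqP e2]|_].
  by rewrite padZ pad_conform ?e1 ?e2 // pad_path.
by rewrite pad0 scaler0.
Qed.

(** A path from [i] to [j] that factors as [p q] does so through one vertex [k]. *)
Lemma lin_ext_mul x y i j :
  lin_ext (block i j) (x * y) = \sum_k lin_ext (block k j) x *m lin_ext (block i k) y.
Proof.
elim/pa_ind: x => [|k p x IH].
  by rewrite mul0r lin_ext0 big1 // => k _; rewrite lin_ext0 mul0mx.
have -> : (k *: of_path K p + x) * y = k *: (of_path K p * y) + x * y.
  by rewrite mulrDl; congr (_ + _); apply: pa_mulZl.
rewrite lin_extD IH.
under [RHS]eq_bigr => l _ do rewrite lin_extD mulmxDl -scalemxAl.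
rewrite big_split /= -scaler_sumr; congr (_ *: _ + _); rewrite {x IH}.
elim/pa_ind: y => [|k' q y IH].
  by rewrite mulr0 lin_ext0 big1 // => l _; rewrite lin_ext0 mulmx0.
have -> : of_path K p * (k' *: of_path K q + y) = k' *: (of_path K p * of_path K q) + of_path K p
  * y.
  by rewrite mulrDr; congr (_ + _); apply: pa_mulZr.
rewrite lin_extD IH.
under [RHS]eq_bigr => l _ do rewrite lin_extD mulmxDr -scalemxAr.
rewrite big_split /= -scaler_sumr; congr (_ *: _ + _); rewrite {y IH}.
have -> : of_path K p * of_path K q = pathM K p q by apply: pa_mulUU.
under eq_bigr => l _ do rewrite !lin_ext_path.
rewrite /pathM; case: eqP => [e|ne].
  rewrite lin_ext_path (bigD1 (psrc p)) //= big1 ?addr0; last first.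
    by move=> l ne; rewrite /block [psrc p == l]eq_sym (negPf ne) mul0mx.
  rewrite /block eqxx -e eqxx andbT (ptgt_pcat e) /=.
  have -> : psrc (pcat e) = psrc q by [].
  by case: eqP => _; case: eqP => _ /=; rewrite ?mulmx0 ?mul0mx // padded_pcat.
rewrite lin_ext0 big1 // => l _; rewrite /block.
case: (psrc p =P l) => [<-|_]; last by rewrite mul0mx.
by case: (ptgt q =P psrc p) => [e|_]; [case: ne|rewrite andbF mulmx0].
Qed.

End PathEval.

(** * The equations of the module scheme *)

Lemma ideal_gen_ideal (R : pzRingType) (S : R -> Prop) : is_ideal (ideal_gen S).
Proof.
split=> [I [] //|x y hx hy I iI SI|a x b hx I iI SI].
  by case: (iI) => _ + _; apply; [apply: hx|apply: hy].
by case: (iI) => _ _; apply; apply: hx.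
Qed.

Section ModuleIdeal.
Variables (K : fieldType) (Q : quiver) (I : path_algebra K Q -> Prop).
Variables (d : vertex Q -> nat) (n : nat).
Hypothesis dn : forall i, (d i <= n)%N.
Hypothesis genI : gen_by_paths2 I.

Local Notation R := {mpoly K[ncoord d]}.
Local Notation X := (@generic_rep K Q d).

Definition rel_pair a b := src a = tgt b /\ in_rel I a b.

(** The elements of the path algebra whose evaluation has all its entries in [J]
    form an ideal, so it suffices to test the paths of length two that generate [I]. *)
Lemma mod_ideal_min (J : R -> Prop) : is_ideal J ->
  (forall a b, rel_pair a b -> mx_in J (pad n (X a) *m pad n (X b))) ->
  forall f, mod_ideal I f -> J f.
Proof.
move=> idJ H f; apply => // {f} _ [x [i [j [k [l [Ix ->]]]]]].
have [rho [len gen]] := genI.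
pose good y := forall i j, mx_in J (lin_ext (@mpolyC (ncoord d) K) (block X n i j) y).
suff gx : good x.
  rewrite -(padK (pa_mx _ _ _ _ _) (dn j) (dn i)); apply: mx_inM => //.
  by rewrite (pad_pa_mx _ _ dn).
have [J0 JD JM] := idJ.
apply: (gen x).1 => //.
  split.
  - by move=> i' j' k' l'; rewrite lin_ext0 mxE.
  - move=> y z gy gz i' j' k' l'; rewrite -[y]scale1r lin_extD rmorph1 scale1r mxE.
    by apply: JD; [apply: gy|apply: gz].
  - move=> a y b gy i' j'.
    rewrite (lin_ext_mul _ _ dn); apply: mx_in_sum => // m _.
    rewrite (lin_ext_mul _ _ dn) mulmx_suml; apply: mx_in_sum => // m' _; exact: mx_inM.
move=> y [p rp ->] i' j'; rewrite lin_ext_path /block; case: ifP => _; last by move=> ? ?;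
  rewrite mxE.
have := len p rp; rewrite /plength /padded_path /psrc /parrows.
have : I (of_path K p) by apply/gen => I' _; apply; exists p.
case: p rp => -[v [|a [|b [|c s]]]] //= w rp Ip _.
have /and3P[/eqP e1 /eqP e2 _] := w.
have hp : of_path K (@QPath Q (v, [:: a; b]) w) = of_arrow K a * of_arrow K b.
  have -> : of_arrow K a * of_arrow K b = pathM K (arrow_path a) (arrow_path b) by apply:
    pa_mulUU.
  rewrite /pathM; case: eqP => [e|[]]; last by [].
  by congr of_path; apply: val_inj; rewrite /= -e2.
rewrite -[v]e2 pad_pidr; apply: H; split=> //.
by rewrite /in_rel -hp.
Qed.

Lemma mod_ideal_rel a b : rel_pair a b ->
  mx_in (@mod_ideal K Q I d) (pad n (X a) *m pad n (X b)).
Proof.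
move=> [e iab]; have idJ := ideal_gen_ideal (fun f => exists x i j k l,
    I x /\ f = pa_mx (@mpolyC (ncoord d) K) X x i j k l).
have -> : pad n (X a) *m pad n (X b) =
    pad n (pa_mx (@mpolyC (ncoord d) K) X (of_arrow K a * of_arrow K b) (src b) (tgt a)).
  rewrite (pad_pa_mx _ _ dn).
  have -> : of_arrow K a * of_arrow K b = pathM K (arrow_path a) (arrow_path b) by apply:
    pa_mulUU.
  rewrite /pathM; case: eqP => [e'|[]]; last by [].
  rewrite lin_ext_path /block.
  have -> : psrc (pcat e') = src b by [].
  have -> : ptgt (pcat e') = tgt a by rewrite ptgt_pcat.
  by rewrite !eqxx (padded_pcat _ dn) /padded_path /= pad_pidr /psrc /= -/(pad n (X b)) !pad_pidr.
rewrite /pad; apply: mx_inM => // k l J _; apply.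
by exists (of_arrow K a * of_arrow K b), (src b), (tgt a), k, l.
Qed.

Definition rep_of (x : 'rV[K]_(ncoord d)) : rep K d :=
  fun a => \matrix_(i, j) x 0 (enum_rank (Tagged _ (i, j) : Defs.coord d)).

Lemma rep_ofK x : rep_point (rep_of x) = x.
Proof.
apply/rowP=> k; rewrite mxE; set u := enum_val k; rewrite /rep_of mxE; congr (x _ _);
  rewrite {}/u; rewrite -[RHS]enum_valK; congr enum_rank.
by case: (enum_val k) => a [i j].
Qed.

Lemma rep_point_ext (M M' : rep K d) :
  (forall a, M a = M' a) -> rep_point M = rep_point M'.
Proof. by move=> e; apply/rowP=> k; rewrite [LHS]mxE [RHS]mxE /= e. Qed.

Lemma rep_pointD k (M M' : rep K d) :
  rep_point (fun a => k *: M a + M' a) = k *: rep_point M + rep_point M'.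
Proof. by apply/rowP=> l; rewrite !mxE /= !mxE. Qed.

Lemma rep_pointK M a : rep_of (rep_point M) a = M a.
Proof. by apply/matrixP=> i j; rewrite mxE rep_pointE. Qed.

Lemma eval_pad (x : 'rV[K]_(ncoord d)) a : map_mx (meval (x 0)) (pad n (X a)) = pad n (rep_of x
  a).
Proof. by rewrite map_pad -{1}(rep_ofK x) meval_generic. Qed.

Lemma zero_locusE x : zero_locus (@mod_ideal K Q I d) x <->
  forall a b, rel_pair a b -> pad n (rep_of x a) *m pad n (rep_of x b) = 0.
Proof.
split=> [H a b rab|H].
  rewrite -!eval_pad -map_mxM; apply/matrixP=> i j; rewrite [LHS]mxE [RHS]mxE.
  by apply: H; apply: mod_ideal_rel.
apply: mod_ideal_min => [|a b rab i j].
  split=> [|f g hf hg|f g h hg]; first exact: meval0.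
    by rewrite mevalD hf hg addr0.
  by rewrite !mevalM hg mulr0 mul0r.
have := H a b rab; rewrite -!eval_pad -map_mxM => /matrixP/(_ i j).
by rewrite [LHS]mxE [RHS]mxE.
Qed.

Section Derivation.
Variables (x v : 'rV[K]_(ncoord d)).

Definition dir_deriv (f : R) := \sum_(k < ncoord d) f^`M(k).@[x 0] * v 0 k.

Lemma dir_derivD f g : dir_deriv (f + g) = dir_deriv f + dir_deriv g.
Proof.
by rewrite /dir_deriv -big_split; apply: eq_bigr => k _; rewrite mderivD mevalD mulrDl.
Qed.

Lemma dir_derivM f g :
  dir_deriv (f * g) = dir_deriv f * g.@[x 0] + f.@[x 0] * dir_deriv g.
Proof.
rewrite /dir_deriv big_distrl big_distrr -big_split; apply: eq_bigr => k _ /=.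
by rewrite mderivM mevalD !mevalM mulrDl mulrAC mulrA.
Qed.

Lemma dir_derivC c : dir_deriv c%:MP = 0.
Proof. by rewrite /dir_deriv big1 // => k _; rewrite mderivC meval0 mul0r. Qed.

Lemma dir_derivX k : dir_deriv 'X_k = v 0 k.
Proof.
rewrite /dir_deriv (bigD1 k) //= big1 ?addr0 => [|l ne].
  have U0 : (U_(k) - U_(k))%MM = 0%MM by apply/mnmP=> j; rewrite mnmBE subnn mnm0E.
  by rewrite mderivX mnm1E eqxx scale1r U0 mpolyX0 meval1 mul1r.
by rewrite mderivX mnm1E eq_sym (negPf ne) scale0r meval0 mul0r.
Qed.

Definition deriv_mx p q (A : 'M[R]_(p, q)) : 'M[K]_(p, q) := \matrix_(i, j) dir_deriv (A i j).

Lemma deriv_mxM p q l (A : 'M[R]_(p, q)) (B : 'M[R]_(q, l)) :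
  deriv_mx (A *m B) = deriv_mx A *m map_mx (meval (x 0)) B + map_mx (meval (x 0)) A *m deriv_mx B.
Proof.
apply/matrixP=> i j; rewrite !mxE (big_morph dir_deriv dir_derivD (dir_derivC 0)).
by rewrite -big_split; apply: eq_bigr => k _; rewrite dir_derivM !mxE.
Qed.

Lemma deriv_mx_pid p q k : deriv_mx (pid_mx k : 'M_(p, q)) = 0.
Proof. by apply/matrixP=> i j; rewrite !mxE -(rmorph_nat (@mpolyC (ncoord d) K)) dir_derivC. Qed.

Lemma deriv_pad a : deriv_mx (pad n (X a)) = pad n (rep_of v a).
Proof.
rewrite /pad !deriv_mxM !deriv_mx_pid mul0mx add0r mulmx0 addr0 !map_pid_mx.
congr (_ *m _ *m _); apply/matrixP=> i j; rewrite !mxE dir_derivX //.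
Qed.

(** The polynomials that vanish at [x] to first order along [v] form an ideal, so
    [mod_ideal_min] reduces the claim to the quadratic relations, where it is the
    product rule. *)
Lemma tangent_spaceE : zero_locus (@mod_ideal K Q I d) x ->
  tangent_space (@mod_ideal K Q I d) x v <->
  forall a b, rel_pair a b -> pad n (rep_of v a) *m pad n (rep_of x b) +
     pad n (rep_of x a) *m pad n (rep_of v b) = 0.
Proof.
move=> Xx; split=> [H a b rab|H].
  rewrite -!(eval_pad x) -!deriv_pad -deriv_mxM; apply/matrixP=> i j; rewrite [LHS]mxE [RHS]mxE.
  by apply: H; apply: mod_ideal_rel.
suff G f : mod_ideal I f -> f.@[x 0] = 0 /\ dir_deriv f = 0 by move=> f /G[].
apply: (@mod_ideal_min (fun f => f.@[x 0] = 0 /\ dir_deriv f = 0)) => [|a b rab i j].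
  split=> [|g h [g1 g2] [h1 h2]|g h k [h1 h2]].
  - by rewrite meval0 -mpolyC0 dir_derivC.
  - by rewrite mevalD dir_derivD g1 g2 h1 h2 !addr0.
  - by rewrite !dir_derivM !mevalM h1 h2 !(mulr0, mul0r, addr0).
split; first by apply: Xx; apply: mod_ideal_rel.
have := H a b rab; rewrite -!(eval_pad x) -!deriv_pad -deriv_mxM => /matrixP/(_ i j).
by rewrite [LHS]mxE [RHS]mxE.
Qed.

End Derivation.

End ModuleIdeal.

Section Families.
Variables (K : fieldType) (Q : quiver) (d : vertex Q -> nat) (n : nat).
Hypothesis dn : forall i, (d i <= n)%N.
Local Notation N := (ncoord d).
Local Notation s := (fun a : arrow Q => d (src a)).
Local Notation t := (fun a : arrow Q => d (tgt a)).

(** A point of the affine space as a family of padded matrices with reversed columns;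
    [unfam] is the inverse on supported families. *)
Definition fam (x : 'rV[K]_N) (a : arrow Q) : 'M[K]_n := pad n (rep_of x a) *m W (d (src a)).

Definition unfam (F : arrow Q -> 'M[K]_n) : 'rV[K]_N :=
  rep_point (fun a => (pid_mx (d (tgt a)) : 'M_(_, n)) *m (F a *m W (d (src a))) *m
    (pid_mx (d (src a)) : 'M_(n, _))).

Lemma fam_supported x : supported s t (fam x).
Proof.
move=> a; split; last by rewrite -mulmxA WP.
by rewrite /fam /lead_proj mulmxA pad_pidl.
Qed.

Lemma fam_pad x a : fam x a *m W (d (src a)) = pad n (rep_of x a).
Proof. by rewrite /fam -mulmxA WW // /lead_proj pad_pidr. Qed.

Lemma unfamK F : supported s t F -> forall a, fam (unfam F) a = F a.
Proof.
move=> sF a; rewrite /fam /pad rep_pointK !mulmxA pid_mx_id // -!mulmxA.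
rewrite (mulmxA (pid_mx (d (src a)))) pid_mx_id // -/(lead_proj K n (d (src a))) -/(lead_proj K n
  (d (tgt a))).
by rewrite PW WW // (sF a).2 (sF a).1.
Qed.

Lemma famK x : unfam (fam x) = x.
Proof.
rewrite -[RHS]rep_ofK; apply/rowP=> k; rewrite !mxE; congr (fun_of_matrix _ _ _).
by rewrite fam_pad padK.
Qed.

Lemma fam_inj x y : fam x =1 fam y -> x = y.
Proof. 
by move=> e; rewrite -[x]famK -[y]famK; apply: rep_point_ext => a; rewrite e.
Qed.

Lemma unfamD k F G : unfam (fun a => k *: F a + G a) = k *: unfam F + unfam G.
Proof.
rewrite /unfam -rep_pointD; apply: rep_point_ext => a.
by rewrite mulmxDl mulmxDr mulmxDl -scalemxAl -scalemxAr -scalemxAl.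
Qed.

Lemma polymx_fam a : polymx (fun x => fam x a).
Proof.
apply: polymx_mul; last exact: polymx_const.
apply: polymx_mul; last exact: polymx_const.
apply: polymx_mul; first exact: polymx_const.
move=> i j; apply: (polyf_ext _ (polyf_coord K _)) => x; rewrite mxE; reflexivity.
Qed.

Lemma polymx_unfam D (F : 'rV[K]_D -> arrow Q -> 'M[K]_n) :
  (forall a, polymx (fun v => F v a)) -> polymx (fun v => unfam (F v)).
Proof.
move=> h i k; pose a := tag (enum_val k : Defs.coord d).
have : polymx (fun v => (pid_mx (d (tgt a)) : 'M_(d (tgt a), n)) *m (F v a *m W (d (src a))) *m
    (pid_mx (d (src a)) : 'M_(n, d (src a)))).
  apply: polymx_mul; last exact: polymx_const.
  apply: polymx_mul; first exact: polymx_const.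
  by apply: polymx_mul; last exact: polymx_const.
move=> /(_ (tagged (enum_val k : Defs.coord d)).1 (tagged (enum_val k : Defs.coord d)).2).
by apply: polyf_ext => v; rewrite [RHS]mxE.
Qed.

Lemma rank_fam M a : \rank (fam (rep_point M) a) = \rank (M a).
Proof.
have rW : (\rank (fam (rep_point M) a) = \rank (pad n (M a)))%N.
  apply/eqP; rewrite eqn_leq; apply/andP; split.
    by rewrite /fam rep_pointK mxrankM_maxl.
  by rewrite -(rep_pointK M) -fam_pad mxrankM_maxl.
rewrite rW; apply/eqP; rewrite eqn_leq; apply/andP; split.
  by apply: leq_trans (mxrankM_maxl _ _) (mxrankM_maxr _ _).
rewrite -{1}(padK (M a) (dn _) (dn _)).
by apply: leq_trans (mxrankM_maxl _ _) (mxrankM_maxr _ _).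
Qed.

Section Relations.
Variables (I : path_algebra K Q -> Prop) (prev : arrow Q -> option (arrow Q)).
Hypothesis genI : gen_by_paths2 I.
Hypothesis prevP : forall a b, prev a = Some b <-> rel_pair I a b.

Lemma zero_locus_complex x :
  zero_locus (@mod_ideal K Q I d) x <-> is_complex s prev (fam x).
Proof.
rewrite (zero_locusE dn genI); split=> H a b rab.
  by rewrite fam_pad /fam mulmxA H ?mul0mx //; apply/prevP.
have e : src a = tgt b by case: rab.
move/prevP: rab => /H; rewrite fam_pad => /(congr1 (mulmx^~ (W (d (src b))))).
by rewrite mul0mx -mulmxA fam_pad.
Qed.

Lemma tangent_space_complex x v : zero_locus (@mod_ideal K Q I d) x ->
  tangent_space (@mod_ideal K Q I d) x v <-> tangent_at s prev (fam x) (fam v).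
Proof.
move=> Xx; rewrite (tangent_spaceE dn genI v Xx); split=> H a b rab.
  by rewrite !fam_pad /fam !(mulmxA (pad n _) (pad n _)) -mulmxDl H ?mul0mx //; apply/prevP.
move/prevP: rab => /H; rewrite !fam_pad => /(congr1 (mulmx^~ (W (d (src b))))).
by rewrite mul0mx mulmxDl -!(mulmxA (pad n _) (fam _ _)) !fam_pad.
Qed.

End Relations.

End Families.

(** * Chains and tangent spaces at a module *)

(** Turns a linear parametrization of a set given by a predicate, as tangent spaces
    are, into a vector space of known dimension. *)
Lemma dim_of_retract (K : fieldType) N D (T : 'rV[K]_N -> Prop)
    (e : 'rV[K]_D -> 'rV[K]_N) (f : 'rV[K]_N -> 'rV[K]_D) :
  linear e -> (forall y, f (e y) = y) -> (forall y, T (e y)) ->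
  (forall v, T v -> e (f v) = v) ->
  exists2 V : {vspace 'rV[K]_N}, (forall v, v \in V <-> T v) & \dim V = D.
Proof.
move=> le fe Te ef.
pose eL : {linear 'rV[K]_D -> 'rV[K]_N} := HB.pack e (GRing.isLinear.Build K _ _ *:%R e le).
have eLE y : linfun eL y = e y by rewrite lfunE.
exists (limg (linfun eL)) => [v|].
  split=> [/memv_imgP[y _ ->]|Tv]; first by rewrite eLE.
  by rewrite -(ef v Tv) -eLE memv_img ?memvf.
rewrite limg_dim_eq ?dimvf; first by rewrite /dim /= mul1n.
apply/eqP; rewrite -subv0; apply/subvP=> y; rewrite memv_cap memv_ker eLE => /andP[_ /eqP ey].
have e0 : e 0 = 0 by exact: (linear0 eL).
by rewrite -(fe y) ey -e0 fe mem0v.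
Qed.

Lemma bounded_max (X : Type) (Q : X -> Prop) (h : X -> nat) B : (exists x, Q x) ->
  (forall x, Q x -> h x <= B)%N -> exists x, Q x /\ forall y, Q y -> (h y <= h x)%N.
Proof.
move=> [x0 Q0] hB; move: {2}(B - h x0)%N (leqnn (B - h x0)%N) => m.
elim: m x0 Q0 => [|m IH] x0 Q0 le.
  exists x0; split=> // y Qy; have := hB y Qy; have := hB x0 Q0; lia.
have [H|H] := classic (forall y, Q y -> (h y <= h x0)%N); first by exists x0.
have [y] := not_all_ex_not _ _ H => {}H.
have [Qy /negP lt] := imply_to_and _ _ H.
by apply: (IH y Qy); have := hB y Qy; lia.
Qed.

Section Frames.
Variables (K : fieldType) (A : finType) (n : nat) (s t : A -> nat).
Variables (prev : A -> option A).

Lemma spreadD (S : {set A * 'I_n * 'I_n}) k (p q : 'rV[K]_#|S|) a :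
  spread (k *: p + q) a = k *: spread p a + spread q a.
Proof.
apply/matrixP=> i j; rewrite !mxE big_distrr -big_split; apply: eq_bigr => l _ /=.
by rewrite !mxE mulrDr mulrCA.
Qed.

Lemma tangent_liftD (r : A -> nat) k (Y Y' Z : A -> 'M[K]_n) :
  (forall a, Z a = k *: Y a + Y' a) ->
  forall a, tangent_lift s prev r Z a = k *: tangent_lift s prev r Y a + tangent_lift s prev r Y'
    a.
Proof.
move=> H a; rewrite /tangent_lift H; case: (prev a) => [b|]; last by rewrite !subr0.
rewrite H mulmxDr !mulmxDl -!(scalemxAl, scalemxAr) scalerBr opprD addrACA.
by rewrite -!mulmxA.
Qed.

Lemma tangent_frame gt gt' gs gs' (F N : A -> 'M[K]_n) :
  frame s t prev gt gt' gs gs' -> tangent_at s prev F N ->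
  tangent_at s prev (fun a => gt a *m F a *m gs a) (fun a => gt a *m N a *m gs a).
Proof.
move=> [_ H] tN a b e.
have E (G1 G2 : A -> 'M[K]_n) : gt a *m G1 a *m gs a *m W (s a) *m (gt b *m G2 b *m gs b) =
    gt a *m (G1 a *m W (s a) *m G2 b) *m gs b.
  by rewrite -[in RHS](H _ _ e) !mulmxA.
by rewrite !E -mulmxDl -mulmxDr tN // mulmx0 mul0mx.
Qed.

Lemma tangent_at_ext (F F' N N' : A -> 'M[K]_n) : F =1 F' -> N =1 N' ->
  tangent_at s prev F N -> tangent_at s prev F' N'.
Proof. by move=> e1 e2 H a b /H; rewrite !e1 !e2. Qed.

Lemma complex_ext (F F' : A -> 'M[K]_n) : F =1 F' ->
  is_complex s prev F -> is_complex s prev F'.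
Proof. by move=> e1 H a b /H; rewrite !e1. Qed.

Lemma supported_proj (r : A -> nat) : (forall a, r a <= t a)%N -> (forall a, r a <= s a)%N ->
  supported s t (fun a => P (r a) : 'M[K]_n).
Proof. by move=> h1 h2 a; rewrite PPr // PPl. Qed.

Lemma rank_frame gt gt' gs gs' (F : A -> 'M[K]_n) : frame s t prev gt gt' gs gs' ->
  supported s t F -> forall a, \rank (gt a *m F a *m gs a) = \rank (F a).
Proof.
move=> fr sF a; apply/eqP; rewrite eqn_leq; apply/andP; split.
  by apply: leq_trans (mxrankM_maxl _ _) (mxrankM_maxr _ _).
rewrite -{1}(mulmxV_frame fr sF).
by apply: leq_trans (mxrankM_maxl _ _) (mxrankM_maxr _ _).
Qed.

End Frames.

Section Gentle.
Variables (K : closedFieldType) (Q : quiver) (I : path_algebra K Q -> Prop).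
Variables (d : vertex Q -> nat).
Variables (prev next : arrow Q -> option (arrow Q)).
Hypothesis genI : gen_by_paths2 I.
Hypothesis prevP : forall a b, prev a = Some b <-> rel_pair I a b.
Hypothesis prev_next : forall a b, prev a = Some b <-> next b = Some a.

Local Notation N := (ncoord d).
Local Notation s := (fun a : arrow Q => d (src a)).
Local Notation t := (fun a : arrow Q => d (tgt a)).
Local Notation X := (zero_locus (@mod_ideal K Q I d)).

Let n := \max_i d i.
Let dn i : (d i <= n)%N. Proof. exact: leq_bigmax. Qed.
Let sn a : (s a <= n)%N. Proof. exact: dn. Qed.
Let tn a : (t a <= n)%N. Proof. exact: dn. Qed.
Let glue a b : prev a = Some b -> s a = t b.
Proof. by move/prevP => [e _]; rewrite /= e. Qed.

Local Notation fam := (@fam K Q d n).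
Local Notation unfam := (@unfam K Q d n).

Let XP x : X x <-> is_complex s prev (fam x).
Proof. exact: zero_locus_complex. Qed.

Let rk x a := \rank (fam x a).

Lemma card_param_set r : admissible_ranks s t prev r ->
  #|param_set n s t prev r| = param_dim s t prev r.
Proof.
move=> adm; apply: (card_ell sn tn (r := r) (u := r)) => a; by case: (adm a).
Qed.

Lemma card_free_set r : admissible_ranks s t prev r ->
  #|free_set n s t prev next r| = tangent_count s t prev next r.
Proof.
move=> adm; apply: (card_ell sn tn) => a; first by case: (adm a).
exact: leq_subr.
Qed.

Lemma admissible_le_src r : admissible_ranks s t prev r -> forall a, (r a <= s a)%N.
Proof. by move=> adm a; case: (adm a) => _; lia. Qed.

Lemma polymx_chart D r (gt gs : arrow Q -> 'M[K]_n) (T : 'rV[K]_D -> arrow Q -> 'M[K]_n) :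
  (forall a, polymx (fun p => T p a)) ->
  polymx (fun p => unfam (fun a => gt a *m param s t prev r (T p) a *m gs a)).
Proof.
move=> hT; apply: polymx_unfam => a; apply: polymx_mul; last exact: polymx_const.
by apply: polymx_mul; [exact: polymx_const|apply: polymx_param].
Qed.

(** Take [x0] in [Z] with the largest sum of ranks among the points with ranks at
    least those of [x], and the chart of its stratum in a frame normalizing [x0]. The
    chart contains the open subset of [Z] where the leading blocks stay invertible:
    the ranks cannot drop there, and by maximality cannot grow. *)
Lemma chain_le_param_dim Z x m : irr_closed Z -> Defs.subset Z X -> Z x ->
  irr_chain Z m -> exists r, [/\ admissible_ranks s t prev r,
    forall a, (rk x a <= r a)%N & (m <= param_dim s t prev r)%N].
Proof.
move=> irrZ ZX Zx chain.
have [||x0 [[Zx0 le0] max0]] := @bounded_max 'rV[K]_N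
   (fun y => Z y /\ forall a, (rk x a <= rk y a)%N) (fun y =>
     \sum_a rk y a)%N (\sum_(a : arrow Q) n)%N.
- by exists x; split.
- by move=> y _; apply: leq_sum => a _; apply: rank_leq_row.
have sF := @fam_supported K Q d n; have cF := (XP x0).1 (ZX _ Zx0).
have [gt [gt' [gs [gs' [fr eF]]]]] := normal_form sn tn prev_next glue (sF x0) cF.
have adm := complex_ranks sn glue (sF x0) cF.
exists (rk x0); split=> //.
(* the coordinates of a point in the frame that normalizes x0 *)
pose back y a := gt' a *m fam y a *m gs' a.
have fr' := frame_sym glue fr.
have sB y : supported s t (back y) by exact: (frame_supported _ fr').
have eB y a : gt a *m back y a *m gs a = fam y a by apply: mulmxV_frame fr' (sF y) a.
have rB y a : \rank (back y a) = rk y a by apply: rank_frame fr' (sF y) a.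
pose q y := \prod_a \det (pivot (back y a) (rk x0 a)).
pose phi p := unfam (fun a => gt a *m param s t prev (rk x0) (@spread K _ n (param_set n s t prev
  (rk x0)) p) a *m gs a).
rewrite -card_param_set //.
apply: (@chain_length_le K N _ Z m phi q) => //.
- by apply: polymx_chart => a; apply: polymx_spread.
- apply: polyf_prod => a; apply: polyf_det.
  apply: polymx_add; last exact: polymx_const.
  apply: polymx_mul; last exact: polymx_const.
  apply: polymx_mul; first exact: polymx_const.
  apply: polymx_mul; last exact: polymx_const.
  by apply: polymx_mul; [exact: polymx_const|exact: polymx_fam].
- exists x0 => //; rewrite /q big1 ?oner_eq0 // => a _.
  have -> : back x0 a = P (rk x0 a).
    rewrite /back eF -/(rk x0 a).
    have sP := supported_proj K n (fun a => (adm a).1) (admissible_le_src adm).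
    exact: (mulmxV_frame fr sP a).
  by rewrite /pivot !PPl // addrC subrK det1.
move=> y Zy qy.
have uB a : pivot (back y a) (rk x0 a) \in unitmx.
  by rewrite unitmxE unitfE; move: qy; rewrite /q (bigD1 a) //= mulf_eq0 negb_or => /andP[].
have rn a : (rk x0 a <= n)%N by apply: rank_leq_row.
have rge a : (rk x0 a <= rk y a)%N.
  rewrite -(rB y).
  have := mxrank_add (P (rk x0 a) *m back y a *m P (rk x0 a)) (1%:M - P (rk x0 a)).
  rewrite -/(pivot _ _) mxrank_unit //.
  have -> : \rank (1%:M - P (rk x0 a) : 'M[K]_n) = (n - rk x0 a)%N by exact: rank_copid_mx.
  rewrite -{1}(subnKC (rn a)) leq_add2r => h; apply: leq_trans h _.
  exact: leq_trans (mxrankM_maxl _ _) (mxrankM_maxr _ _).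
have req a : rk y a = rk x0 a.
  have le : (\sum_a rk y a <= \sum_a rk x0 a)%N.
    by apply: max0; split=> // c; apply: leq_trans (le0 c) (rge c).
  have := leq_trans (leq_trans (eq_leq (erefl _)) le) (leqnn _).
  rewrite (bigD1 a) //= [X in (_ <= X)%N](bigD1 a) //= => le2.
  have : (\sum_(i | i != a) rk x0 i <= \sum_(i | i != a) rk y i)%N.
    by apply: leq_sum => c _; apply: rge.
  by have := rge a; lia.
have cB : is_complex s prev (back y).
  by apply: (frame_complex fr') => //; apply/XP/ZX.
have [T HT] := param_surj sn tn glue adm (sB y) cB (fun a => eq_leq (etrans (rB y a) (req a))) uB.
exists (gather (param_set n s t prev (rk x0)) T).
apply: (fam_inj dn) => a; rewrite unfamK //; last first.
  exact: (frame_supported _ fr).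
rewrite (param_ext adm (T' := T)) => [|c i j]; last exact: gatherK.
by rewrite HT eB.
Qed.

Lemma tangent_dimE x : X x ->
  forall D, tangent_dim (@mod_ideal K Q I d) x D <-> D = tangent_count s t prev next (rk x).
Proof.
move=> Xx; have sF := @fam_supported K Q d n; have cF := (XP x).1 Xx.
have [gt [gt' [gs [gs' [fr eF]]]]] := normal_form sn tn prev_next glue (sF x) cF.
have adm := complex_ranks sn glue (sF x) cF.
have fr' := frame_sym glue fr.
pose S := free_set n s t prev next (rk x).
pose e (y : 'rV[K]_#|S|) := unfam (fun a => gt a *m tangent_lift s prev (rk x) (spread y) a *m gs
  a).
pose f v := gather S (fun a => gt' a *m fam v a *m gs' a).
have oS y : on_free s t prev next (rk x) (@spread K _ n S y) by move=> a i j; apply: spread_out.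
have sE y : supported s t (tangent_lift s prev (rk x) (@spread K _ n S y)).
  exact: (tangent_lift_supported adm (oS y)).
have fe y a : fam (e y) a = gt a *m tangent_lift s prev (rk x) (@spread K _ n S y) a *m gs a.
  by rewrite unfamK //; apply: (frame_supported _ fr).
have TP v : tangent_space (@mod_ideal K Q I d) x v <-> tangent_at s prev (fam x) (fam v).
  exact: tangent_space_complex.
have sP := supported_proj K n (fun a => (adm a).1) (admissible_le_src adm).
have [||||V HV dV] := @dim_of_retract K N #|S| (tangent_space (@mod_ideal K Q I d) x) e f.
- move=> k y z; rewrite -unfamD; apply: (fam_inj dn) => a.
  rewrite fe unfamK //; last first.
    move=> c /=; have [e1 e2] := frame_supported (tangent_lift s prev (rk x) (spread y)) fr c.
    have [e3 e4] := frame_supported (tangent_lift s prev (rk x) (spread z)) fr c.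
    by rewrite mulmxDr mulmxDl -scalemxAr -scalemxAl e1 e2 e3 e4.
  rewrite (tangent_liftD s prev (rk x) (spreadD k y z)) mulmxDr mulmxDl.
  by rewrite -scalemxAr -scalemxAl.
- move=> y; apply/rowP=> k; rewrite mxE fe (mulmxV_frame fr (sE y)).
  rewrite -spread_val; have := enum_valP k.
  case: (enum_val k) => -[a i] j h; exact: (tangent_lift_free adm).
- move=> y; apply/TP; apply: (tangent_at_ext (F := fun a => gt a *m P (rk x a) *m gs a) (N :=
    fun a => gt a *m tangent_lift s prev (rk x) (@spread K _ n S y) a *m gs a)).
  + by move=> a; rewrite -eF.
  + by move=> a; rewrite fe.
  apply: (tangent_frame fr); exact: (tangent_lift_tangent sn prev_next glue adm).
- move=> v /TP tv; apply: (fam_inj dn) => a; rewrite fe.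
  have tB : tangent_at s prev (fun a => P (rk x a)) (fun a => gt' a *m fam v a *m gs' a).
    apply: tangent_at_ext (tangent_frame fr' tv) => // c.
    by rewrite eF (mulmxV_frame fr sP).
  have sB : supported s t (fun a => gt' a *m fam v a *m gs' a) by apply: (frame_supported _ fr').
  rewrite -(tangent_lift_onto sn prev_next glue adm sB tB).
    by rewrite (mulmxV_frame fr' (sF v)).
  move=> c i j; case: ifP => [h|/negbT h]; [exact: gatherK|exact: spread_out].
move=> D; rewrite -card_free_set // -dV; split=> [[V' HV' <-]|->]; last by exists V.
by congr (\dim _); apply/vspaceP=> v; apply/idP/idP=> [/HV'/HV|/HV/HV'].
Qed.

(** The closure of the stratum with the filled ranks, in a frame normalizing [x].
    It contains [x] because the normal form of [x] is the image of a parameter with a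
    singular middle block. *)
Lemma unobstructed_chain x : X x -> ~ obstructed s t prev next (rk x) ->
  exists Y, [/\ irr_closed Y, Defs.subset Y X, Y x
    & irr_chain Y (tangent_count s t prev next (rk x))].
Proof.
move=> Xx nob; have sF := @fam_supported K Q d n; have cF := (XP x).1 Xx.
have [gt [gt' [gs [gs' [fr eF]]]]] := normal_form sn tn prev_next glue (sF x) cF.
have adm := complex_ranks sn glue (sF x) cF.
have fr' := frame_sym glue fr.
have [adm' dimE] := fill_ranks_spec prev_next glue adm nob.
pose r := fill_ranks s t prev next (rk x); rewrite -/r in adm' dimE.
have le a : (rk x a <= r a)%N by apply: leq_addr.
pose S := param_set n s t prev r.
pose T p := @spread K _ n S p.
pose phi p := unfam (fun a => gt a *m param s t prev r (T p) a *m gs a).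
have fphi p a : fam (phi p) a = gt a *m param s t prev r (T p) a *m gs a.
  by rewrite unfamK //; apply: (frame_supported _ fr).
have pphi : polymx phi by apply: polymx_chart => a; apply: polymx_spread.
have sP p : supported s t (param s t prev r (T p)) by apply: param_supported.
exists (closure_of (fun x => exists2 p, True & x = phi p)); split.
- by apply: (irr_closure_image (A := fun _ => True)) => //; exists 0.
- apply: closure_min; first by exists (@mod_ideal K Q I d).
  move=> _ [p _ ->]; apply/XP; apply: complex_ext (frame_complex fr (sP p) _).
    by move=> a; rewrite fphi.
  exact: param_complex.
- apply: closure_sub; exists (gather S (fun a => P (rk x a))) => //.
  apply: (fam_inj dn) => a; rewrite fphi eF.
  rewrite (param_ext adm' (T' := fun a => P (rk x a))) => [|c i j]; last exact: gatherK.
  by rewrite param_proj.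
rewrite -dimE -card_param_set //.
pose b := gather S (fun a => P (r a) : 'M[K]_n).
pose isC (k : 'I_#|S|) := let u := enum_val k in ((u.1.2 < r u.1.1) && (u.2 < r u.1.1))%N.
(* the entries of the outer factors first, those of the middle factor last *)
pose L := filter (predC isC) (enum 'I_#|S|) ++ filter (predC (predC isC)) (enum 'I_#|S|).
have permL : perm_eq L (enum 'I_#|S|) by rewrite /L perm_filterC.
have szL : size L = #|S| by rewrite (perm_size permL) size_enum_ord.
suff: irr_chain (closure_of (fun x => exists2 p, True & x = phi p)) (size L) by rewrite szL.
pose G (k : 'I_#|S|) y := let u := enum_val k in (gt' u.1.1 *m fam y u.1.1 *m gs' u.1.1) u.1.2
  u.2.
apply: (image_chain (b := b) (G := G)) => //.
- move=> k; apply: polymx_mul; last exact: polymx_const.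
  by apply: polymx_mul; [exact: polymx_const|exact: polymx_fam].
- by rewrite (perm_uniq permL) enum_uniq.
move=> k p Hp; rewrite /G fphi (mulmxV_frame fr (sP p)).
have := spread_val p k; rewrite -/(T p) => <-.
have := enum_valP k; set u := enum_val k; case Ck: (isC k).
  by move=> _; move: Ck => /andP[h1 h2]; apply: param_entryC.
have eC : core r (T p) u.1.1 = P (r u.1.1).
  apply/matrixP=> i j; rewrite /core mulPr mulPl.
  case: (ltnP j (r u.1.1)) => hj; last first.
    rewrite PE; case: eqP => //= e; case: ltnP => // h.
    by move: hj; rewrite -e leqNgt h.
  case: (ltnP i (r u.1.1)) => hi; last by rewrite PE [(i < _)%N]ltnNge hi andbF.
  have uS : (u.1.1, i, j) \in S by rewrite inE /= hj (leq_trans hi (adm' _).1).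
  have [l el] : exists l : 'I_#|S|, enum_val l = (u.1.1, i, j).
    by exists (enum_rank_in uS (u.1.1, i, j)); rewrite enum_rankK_in.
  have := spread_val p l; rewrite el /= -/(T p) => ->; rewrite Hp; last first.
    have kL : k \in filter (predC isC) (enum 'I_#|S|).
      by rewrite mem_filter /= Ck mem_enum.
    have lL : l \notin filter (predC isC) (enum 'I_#|S|).
      by rewrite mem_filter /= /isC el /= hi hj.
    by rewrite /L !index_cat kL (negPf lL) ltn_addr // index_mem.
  by rewrite mxE el.
rewrite (surjective_pairing u) (surjective_pairing u.1) => h; exact: param_entry.
Qed.
End Gentle.

(** * The singularity criterion *)

Lemma irr_chain_extend (K : fieldType) N (Y Z : 'rV[K]_N -> Prop) m :
  irr_chain Y m -> irr_closed Z -> Defs.subset Y Z -> ~ Defs.subset Z Y ->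
  irr_chain Z m.+1.
Proof.
move=> [F [H1 H2]] irrZ YZ nZY.
exists (fun i => if (i <= m)%N then F i else Z); split=> i le.
  by case: ifP => h; [have [h1 h2] := H1 i h; split=> // y /h2/YZ|split].
rewrite ltnS in le; rewrite le; case: ifP => h; first exact: H2.
have -> : i = m by apply/eqP; rewrite eqn_leq le leqNgt h.
have [_ h2] := H1 m (leqnn m).
by split=> [y /h2/YZ|sub] //; apply: nZY => y /sub/h2.
Qed.

Lemma gentle_prev_next (K : fieldType) (Q : quiver) (I : path_algebra K Q -> Prop) :
  gentle I -> exists prev next : arrow Q -> option (arrow Q),
    (forall a b, prev a = Some b <-> rel_pair I a b) /\
    (forall a b, prev a = Some b <-> next b = Some a).
Proof.
move=> gI.
have pick (R : arrow Q -> arrow Q -> Prop) :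
    (forall a b b', R a b -> R a b' -> b = b') ->
    exists f : arrow Q -> option (arrow Q), forall a b, f a = Some b <-> R a b.
  move=> uniq.
  apply: (@fin_all_exists _ _ (fun a (o : option (arrow Q)) => forall b, o = Some b <->
    R a b)) => a.
  have [[b Rab]|no] := classic (exists b, R a b).
    by exists (Some b) => b'; split=> [[<-] //|/(uniq _ _ _ Rab) ->].
  by exists None => b; split=> // Rab; case: no; exists b.
have [|prev prevP] := pick (rel_pair I).
  move=> a b b' [e iab] [e' iab']; apply/eqP/negP => /negP ne.
  by case: (gentle_post gI (c := a) ne) => //; [rewrite -e|case|case].
have [|next nextP] := pick (fun b a => rel_pair I a b).
  move=> b a a' [e iab] [e' iab']; apply/eqP/negP => /negP ne.
  by case: (gentle_pre gI (c := b) ne) => //; [rewrite e|case|case].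
exists prev, next; split=> // a b; split.
  by move/prevP/nextP.
by move/nextP/prevP.
Qed.

Close Scope ring_scope.

Theorem theorem7p6 (K : closedFieldType) (Q : quiver)
    (I : path_algebra K Q -> Prop) (d : vertex Q -> nat) (M : rep K d) :
  gentle I -> mod_scheme_pt I M ->
  let r := fun a : arrow Q => \rank (M a) in
  singular_module I M <->
  exists a b : arrow Q,
    (src a = tgt b /\ in_rel I a b) /\
    [/\ [/\ r a < d (tgt a), r b < d (src b) & r a + r b < d (src a)],
        forall a' : arrow Q,
          src a' = tgt a -> in_rel I a' a -> r a' + r a < d (tgt a)
      & forall b' : arrow Q,
          tgt b' = src b -> in_rel I b b' -> r b + r b' < d (src b)].
Proof.
move=> gI XM r; have genI := gentle_gen gI.
have [prev [next [prevP prev_next]]] := gentle_prev_next gI.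
pose s (a : arrow Q) := d (src a); pose t (a : arrow Q) := d (tgt a).
pose x := rep_point M; pose n := \max_i d i.
have dn i : (d i <= n)%N by apply: leq_bigmax.
have sn a : (s a <= n)%N by apply: dn.
have glue a b : prev a = Some b -> s a = t b by rewrite /s /t => /prevP[->].
have Er a : \rank (fam n x a) = r a by apply: rank_fam.
pose rx a := \rank (fam n x a).
have adm : admissible_ranks s t prev rx.
  apply: (complex_ranks sn glue); first exact: fam_supported.
  exact: (zero_locus_complex dn genI prevP x).1.
have chain_le Z m : irr_closed Z -> Defs.subset Z (zero_locus (@mod_ideal K Q I d)) -> Z x ->
    irr_chain Z m -> exists r', [/\ admissible_ranks s t prev r', forall a, (rx a <= r' a)%N
      & (m <= param_dim s t prev r')%N].
  by move=> h1 h2 h3 h4; apply: (chain_le_param_dim genI prevP prev_next h1 h2 h3 h4).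
have chain_le' Z m : irr_closed Z -> Defs.subset Z (zero_locus (@mod_ideal K Q I d)) -> Z x ->
    irr_chain Z m -> (m <= tangent_count s t prev next rx)%N.
  move=> h1 h2 h3 /(chain_le _ _ h1 h2 h3) [r' [adm' le lem]].
  exact: leq_trans lem (param_dim_le prev_next glue adm adm' le).
have tdim D : tangent_dim (@mod_ideal K Q I d) x D <-> D = tangent_count s t prev next rx.
  exact: (tangent_dimE genI prevP prev_next XM).
have -> : singular_module I M <-> obstructed s t prev next rx.
  split=> [sing|obs [D /tdim -> [[Z [[irrZ ZX _] Zx [ch _]]] _]]]; last first.
    have [r' [adm' le]] := chain_le _ _ irrZ ZX Zx ch.
    by rewrite leqNgt (param_dim_lt prev_next glue adm adm' le obs).
  apply: NNPP => nob; apply: sing.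
  exists (tangent_count s t prev next rx); first exact/tdim.
  have [Y [irrY YX Yx chY]] := unobstructed_chain genI prevP prev_next XM nob.
  split; last by move=> Z D' [irrZ ZX _] Zx [ch _]; apply: chain_le' ch.
  exists Y; split=> //; last by split=> // m; apply: chain_le'.
  split=> // Z irrZ ZX YZ; apply: NNPP => nZY.
  have := chain_le' _ _ irrZ ZX (YZ _ Yx) (irr_chain_extend chY irrZ YZ nZY).
  by rewrite ltnn.
split=> [[a [b [e ha hb hab]]]|[a [b [rab [[h1 h2 h3] ha hb]]]]].
  rewrite /rx !Er in ha hb hab.
  exists a, b; split; first exact/prevP.
  split; first by split=> //; [apply: leq_ltn_trans (leq_addr _ _) ha|apply: leq_ltn_trans
    (leq_addr _ _) hb].
    move=> a' e' i'; have na : next a = Some a' by apply/prev_next/prevP.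
    by move: ha; rewrite na /= Er addnC.
  move=> b' e' i'; have pb : prev b = Some b' by apply/prevP.
  by move: hb; rewrite pb /= Er.
have e : prev a = Some b by apply/prevP.
exists a, b; rewrite /rx !Er; split=> //.
  case na: (next a) => [a'|] /=; last by rewrite addn0.
  by rewrite Er addnC; have /prev_next/prevP[e1 e2] := na; apply: ha.
case pb: (prev b) => [b'|] /=; last by rewrite addn0.
by rewrite Er; have /prevP[e1 e2] := pb; apply: hb.
Qed.
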